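(* Let $G$ be a finite simple graph of order $n$ and size $m\ge 1$, with chromatic number $\chi$ and least adjacency eigenvalue $\lambda$. Then $$\chi(\chi-1)\le m+1-\lambda^2+\sqrt{(m+1-\lambda^2)^2-4(\lambda^2-1)(\lambda^2-m)}.$$ Moreover, equality holds if and only if either $G\cong K_\chi\cup (n-\chi)K_1$, or $\chi=2$ and $G\cong K_{a,b}\cup (n-a-b)K_1$ for some integers $a,b\ge 1$.
   Context: All graphs are finite and simple. The order of $G$ is its number of vertices and the size of $G$ is its number of edges. The least eigenvalue $\lambda=\lambda(G)$ is the smallest eigenvalue of the adjacency matrix $A(G)$. $K_\chi$ is the complete graph on $\chi$ vertices, $K_{a,b}$ is the complete bipartite graph with part sizes $a$ and $b$, $G\cup H$ denotes disjoint union, $tK_1$ is the graph consisting of $t$ isolated vertices, and by convention $G\cup 0K_1=G$. *)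

(* Defs.v *)
From HB Require Import structures.
From mathcomp Require Import all_boot all_order all_algebra.

Set Implicit Arguments.
Unset Strict Implicit.
Unset Printing Implicit Defensive.

Import Order.TTheory GRing.Theory Num.Theory.

Local Open Scope ring_scope.

Record sgraph := SGraph {
  vertex :> finType;
  adj : rel vertex;
  adj_sym : symmetric adj;
  adj_irrefl : irreflexive adj
}.

Definition giso (G H : sgraph) : Prop :=
  exists2 f : G -> H, bijective f & forall x y : G, adj (f x) (f y) = adj x y.

(* The pairs (x, y) and (y, x) give the same two-element set, so every edge is
   counted once in gsize. *)
Definition edges (G : sgraph) : {set {set G}} :=
  [set [set p.1; p.2] | p : G * G & adj p.1 p.2].

Definition gsize (G : sgraph) : nat := #|edges G|.

Definition colorable (G : sgraph) (k : nat) : bool :=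
  [exists c : {ffun G -> 'I_k}, [forall x, forall y, adj x y ==> (c x != c y)]].

Lemma ex_colorable (G : sgraph) : exists k, colorable G k.
Proof.
exists #|G|; apply/existsP; exists [ffun x => enum_rank x].
apply/forallP=> x; apply/forallP=> y; apply/implyP=> xy.
rewrite !ffunE; apply: contraTneq xy => /enum_rank_inj ->.
by rewrite adj_irrefl.
Qed.

Definition chromatic_number (G : sgraph) : nat := ex_minn (ex_colorable G).

Definition adjacency (R : pzRingType) (G : sgraph) : 'M[R]_#|G| :=
  \matrix_(i, j) (adj (enum_val i) (enum_val j))%:R.

(* [eigenvalue] refers to left (row) eigenvectors, which makes no difference for
   the symmetric matrices [adjacency R G]; over a real closed field all their
   eigenvalues lie in R. *)
Definition is_least_eigenvalue (R : realFieldType) (n : nat) (A : 'M[R]_n)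
    (lambda : R) : Prop :=
  eigenvalue A lambda /\ (forall mu : R, eigenvalue A mu -> lambda <= mu).

Definition complete_adj (k : nat) : rel 'I_k := fun x y => x != y.

Lemma complete_sym k : symmetric (@complete_adj k).
Proof. by move=> x y; rewrite /complete_adj eq_sym. Qed.

Lemma complete_irrefl k : irreflexive (@complete_adj k).
Proof. by move=> x; rewrite /complete_adj eqxx. Qed.

Definition complete_graph (k : nat) : sgraph :=
  SGraph (@complete_sym k) (@complete_irrefl k).

Definition bipartite_adj (a b : nat) : rel ('I_a + 'I_b)%type := fun x y =>
  match x, y with
  | inl _, inr _ | inr _, inl _ => true
  | _, _ => false
  end.

Lemma bipartite_sym a b : symmetric (@bipartite_adj a b).
Proof. by move=> [x|x] [y|y]. Qed.

Lemma bipartite_irrefl a b : irreflexive (@bipartite_adj a b).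
Proof. by move=> [x|x]. Qed.

Definition complete_bipartite (a b : nat) : sgraph :=
  SGraph (@bipartite_sym a b) (@bipartite_irrefl a b).

Definition empty_adj (t : nat) : rel 'I_t := fun _ _ => false.

Lemma empty_sym t : symmetric (@empty_adj t).
Proof. by []. Qed.

Lemma empty_irrefl t : irreflexive (@empty_adj t).
Proof. by []. Qed.

Definition empty_graph (t : nat) : sgraph :=
  SGraph (@empty_sym t) (@empty_irrefl t).

Definition union_adj (G H : sgraph) : rel (G + H)%type := fun x y =>
  match x, y with
  | inl x', inl y' => adj x' y'
  | inr x', inr y' => adj x' y'
  | _, _ => false
  end.

Lemma union_sym G H : symmetric (@union_adj G H).
Proof. by move=> [x|x] [y|y] //=; rewrite adj_sym. Qed.

Lemma union_irrefl G H : irreflexive (@union_adj G H).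
Proof. by move=> [x|x] /=; rewrite adj_irrefl. Qed.

Definition disjoint_union (G H : sgraph) : sgraph :=
  SGraph (@union_sym G H) (@union_irrefl G H).

(* Main.v *)
Require Import Defs.
From HB Require Import structures.
From mathcomp Require Import all_boot all_order all_algebra.
From mathcomp Require Import spectral sesquilinear complex zify ring lra.

Set Implicit Arguments.
Unset Strict Implicit.
Unset Printing Implicit Defensive.

Import Order.TTheory GRing.Theory Num.Theory.

(* Write [s = lambda^2], [mu = - lambda > 0], [y = 'C(chi, 2)] and [e = m - y].
   The bound says [s (s - 1) <= e (s + y - 1)], the difference of the two sides
   being a quarter of the discriminant minus [(2 y - (m + 1 - s))^2].
   Two estimates of [s] compete.  Splitting the vertices by the sign of a
   [lambda]-eigenvector, [s] is at most the number of edges across, and the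
   edges inside the two parts number at least [chi (chi - 2) / 4], one more if
   [G] has no [chi]-clique.  On the other hand [G] contains a set [W] of
   [chi + z] vertices spanning a graph of minimum degree at least [chi - 1]; its
   complement has maximum degree at most [z], so [W] contributes at most [1 + z]
   to [mu], and weighted AM-GM on the edges outside [W] gives
   [mu^2 <= (1 + z) mu + e - z (chi - 1) / 2].  The second estimate settles small
   [e] and the first large [e]; for [chi >= 3] and [e > 0] the inequality is
   strict.  If [e = 0] the edges form a clique, and if [chi = 2] the inequality
   reads [s <= m], with equality for complete bipartite graphs only. *)

(** * Colourings, minimum degree and numbers of arcs *)

(** Convexity: with [n = p + q] the right side is at least [n * (n - 2)], which grows with
    [n >= k + 1]. Later [p] and [q] are the numbers of colours used on the two sides of a cut. *)
Lemma split_bound p q k : k < p + q -> k.+1 * k.-1 <= 2 * (p * p.-1 + q * q.-1).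
Proof.
move=> kpq; apply: (@leq_trans ((p + q) * (p + q).-2)); first by apply: leq_mul; lia.
clear k kpq; wlog le : p q / p <= q.
  by move=> h; case: (leqP p q) => [/h //|/ltnW/h]; rewrite [q + p]addnC [q * _ + _]addnC.
have [d ->] : exists d, q = p + d by exists (q - p); lia.
case: p {le} => [|p]; first by case: d => [|[|d]] //=; nia.
rewrite !addSn ?addnS /=; nia.
Qed.
(** The gain of 4 can fail only when [p + q = k + 1] with both at least 2; that case is settled by
    the structure of the two sides instead. *)
Lemma split_bound_unbalanced p q k : 2 < k -> k < p + q -> [|| k.+1 < p + q, p <= 1 | q <= 1] ->
  k.+1 * k.-1 + 4 <= 2 * (p * p.-1 + q * q.-1).
Proof.
move=> k3 kpq /or3P[lt|p1|q1].
- apply: leq_trans _ (split_bound lt); case: k k3 {kpq lt} => [|[|k]] //= ; nia.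
- apply: (@leq_trans (2 * (k * k.-1))); first by case: k k3 {kpq} => [|[|[|k]]] //= _; nia.
  rewrite leq_mul2l /=; apply: leq_trans _ (leq_addl _ _); apply: leq_mul; lia.
- apply: (@leq_trans (2 * (k * k.-1))); first by case: k k3 {kpq} => [|[|[|k]]] //= _; nia.
  rewrite leq_mul2l /=; apply: leq_trans _ (leq_addr _ _); apply: leq_mul; lia.
Qed.

Section Colouring.
Variable G : sgraph.
Implicit Types (U W P N A : {set G}) (k p q : nat).

Definition colors_in U k := exists c : G -> nat,
  {in U, forall x, c x < k} /\ {in U &, forall x y, adj x y -> c x != c y}.

Definition deg_in W x := #|[set y in W | adj x y]|.

(* Every edge counts twice. *)
Definition arcs (D : rel G) := #|[set p : G * G | adj p.1 p.2 && D p.1 p.2]|.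

Definition arcs_in U := arcs (fun x y => (x \in U) && (y \in U)).

Definition clique W := {in W &, forall x y, x != y -> adj x y}.

(** In the usual terms, the graph induced on [U] has a nonempty [k]-core. *)
Definition dense U k := [exists W : {set G},
  [&& W \subset U, W != set0 & [forall x in W, k <= deg_in W x]]].

Lemma card_pairs (D : rel G) :
  #|[set p : G * G | D p.1 p.2]| = \sum_x #|[set y | D x y]|.
Proof.
rewrite -sum1dep_card.
rewrite -(pair_big_dep xpredT D (fun _ _ => 1)) /=.
by apply: eq_bigr => x _; rewrite sum1dep_card.
Qed.

Lemma arcs_inE U : arcs_in U = \sum_(x in U) deg_in U x.
Proof.
rewrite /arcs_in /arcs (card_pairs (fun x y => adj x y && ((x \in U) && (y \in U)))).
rewrite [RHS]big_mkcond; apply: eq_bigr => x _ /=.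
case: (x \in U); last by apply/eqP; rewrite cards_eq0; apply/eqP/setP=> y; rewrite !inE andbF.
by apply: eq_card => y; rewrite !inE andbC.
Qed.

Lemma arcs_sub (D D' : rel G) : (forall x y, adj x y -> D x y -> D' x y) -> arcs D <= arcs D'.
Proof.
move=> DD'; apply/subset_leq_card/subsetP => -[x y]; rewrite !inE /= => /andP[xy Dxy].
by rewrite xy DD'.
Qed.

Lemma arcsU (D D' E : rel G) :
  (forall x y, adj x y -> D x y -> ~~ D' x y) ->
  (forall x y, adj x y -> D x y || D' x y -> E x y) -> arcs D + arcs D' <= arcs E.
Proof.
move=> disj sub; rewrite /arcs.
rewrite -leq_subRL; last by apply: arcs_sub => x y xy Dxy; rewrite sub ?Dxy.
have sDE : [set p : G * G | adj p.1 p.2 && D p.1 p.2] \subset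
           [set p : G * G | adj p.1 p.2 && E p.1 p.2].
  by apply/subsetP => -[x y]; rewrite !inE /= => /andP[xy Dxy]; rewrite xy sub ?Dxy.
rewrite -{1}(setIidPr sDE) -cardsD; apply/subset_leq_card/subsetP => -[x y].
rewrite !inE /= => /andP[xy D'xy]; rewrite xy sub ?D'xy ?orbT //= andbT.
by apply: contraL D'xy => Dxy; apply: disj.
Qed.

Lemma arcs_inS U W : W \subset U -> arcs_in W <= arcs_in U.
Proof.
by move=> /subsetP WU; apply: arcs_sub => x y _ /andP[/WU-> /WU->].
Qed.

Lemma arcs_pair (D : rel G) x y : adj x y -> D x y -> D y x -> 2 <= arcs D.
Proof.
move=> xy Dxy Dyx; have xNy : x != y by apply: contraTneq xy => ->; rewrite adj_irrefl.
rewrite -(_ : #|[set (x, y); (y, x)]| = 2); last first.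
  by rewrite cards2 xpair_eqE (negPf xNy).
apply/subset_leq_card/subsetP => p; rewrite !inE.
by case/orP=> /eqP-> /=; rewrite ?xy ?Dxy // adj_sym xy.
Qed.

Lemma arcs_gsize : arcs (fun _ _ => true) = 2 * gsize G.
Proof.
rewrite /gsize /edges /arcs.
pose f (p : G * G) := [set p.1; p.2].
rewrite (eq_card (B := [set p : G * G | adj p.1 p.2])); last by move=> p; rewrite !inE andbT.
rewrite -sum1_card (partition_big_imset f) /= mulnC -[RHS]/(_ * 2).
rewrite (eq_bigr (fun _ => 2)) ?sum_nat_const //=.
move=> e /imsetP[[x y]]; rewrite inE /= => xy ->.
have xNy : x != y by apply: contraTneq xy => ->; rewrite adj_irrefl.
rewrite sum1dep_card -(_ : #|[set (x, y); (y, x)]| = 2); last first.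
  by rewrite cards2 xpair_eqE (negPf xNy).
apply: eq_card => -[u v]; rewrite !inE /f /= !xpair_eqE.
apply/andP/orP => [[uv /eqP/setP E]|[]/andP[/eqP-> /eqP->]]; last 2 first.
- by rewrite xy.
- by rewrite adj_sym xy setUC.
have uNv : u != v by apply: contraTneq uv => ->; rewrite adj_irrefl.
have := E x; have := E u; have := E v; rewrite !inE !eqxx ?orbT /= => /esym.
case/orP => /eqP vE /esym /orP[] /eqP uE; subst u v; rewrite ?eqxx //; auto.
all: by rewrite eqxx in uNv.
Qed.

Lemma colors_in_leq U k p : k <= p -> colors_in U k -> colors_in U p.
Proof.
by move=> kp [c [ck cp]]; exists c; split=> // x xU; apply: leq_trans kp; apply: ck.
Qed.

Lemma colors_inU U W k p : colors_in U k -> colors_in W p -> colors_in (U :|: W) (k + p).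
Proof.
move=> [c [ck cp]] [d [dp dq]]; exists (fun x => if x \in U then c x else k + d x).
split=> [x|x y]; rewrite !inE.
  case: ifPn => [xU _|_ /= xW]; first by apply: ltn_addr; apply: ck.
  by rewrite ltn_add2l dp.
case: ifPn => [xU _|_ /= xW]; case: ifPn => [yU _|_ /= yW] xy; first exact: cp.
- by rewrite neq_ltn ltn_addr ?ck.
- by rewrite neq_ltn [_ < k + _]ltn_addr ?ck ?orbT.
- by rewrite eqn_add2l dq.
Qed.

Lemma denseP U k : reflect
  (exists W, [/\ W \subset U, W != set0 & {in W, forall x, k <= deg_in W x}]) (dense U k).
Proof.
apply: (iffP existsP) => -[W]; first by case/and3P=> ? ? /forall_inP ?; exists W.
by case=> ? ? ?; exists W; apply/and3P; split=> //; apply/forall_inP.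
Qed.

Lemma deg_in_lt W x : x \in W -> deg_in W x < #|W|.
Proof.
move=> xW; rewrite (cardsD1 x) xW add1n ltnS; apply/subset_leq_card/subsetP=> y.
by rewrite !inE => /andP[-> xy]; rewrite andbT; apply: contraTneq xy => ->; rewrite adj_irrefl.
Qed.

(* If every nonempty subset has a vertex with fewer than [k] neighbours in it,
   greedy colouring in the degeneracy order uses only [k] colours. *)
Lemma dense_or_colors U k : dense U k \/ colors_in U k.
Proof.
elim: {U}_.+1 {-2}U (ltnSn #|U|) => // n IHn U; rewrite ltnS => Un.
have [/forall_inP degU|/forall_inPn[x xU degx]] :=
  boolP [forall x in U, k <= deg_in U x].
  have [->|U0] := eqVneq U set0; first by right; exists (fun=> 0); split=> x; rewrite inE.
  by left; apply/denseP; exists U.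
have /IHn [/denseP[W [WU W0 degW]]|[c [ck cp]]] : #|U :\ x| < n.
- by move: Un; rewrite (cardsD1 x) xU.
- left; apply/denseP; exists W; split=> //.
  by apply: subset_trans WU _; apply: subsetDl.
right; pose L := [seq c y | y <- enum [set y in U | adj x y]].
have [i ik iL] : exists2 i, i < k & i \notin L.
  have [/allP kL|/allPn[j]] := boolP (all (mem L) (iota 0 k)).
    have := uniq_leq_size (iota_uniq 0 k) kL.
    by rewrite size_iota size_map -cardE leqNgt ltnNge degx.
  by rewrite mem_iota => /andP[_ jk] jL; exists j.
exists (fun y => if y == x then i else c y); split=> [y yU|y z yU zU yz].
  by case: eqVneq => // yx; apply: ck; rewrite !inE yx.
have notL w : w \in U -> adj x w -> i != c w.
  move=> wU xw; apply: contraNneq iL => ->; apply: map_f.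
  by rewrite mem_enum inE wU.
case: (eqVneq y x) => yx; case: (eqVneq z x) => zx.
- by rewrite yx zx adj_irrefl in yz.
- by apply: notL; rewrite // -yx.
- by rewrite eq_sym; apply: notL; rewrite // -zx adj_sym.
- by apply: cp; rewrite // !inE ?yx ?zx.
Qed.

Lemma dense_arcs U k : dense U k -> k.+1 * k <= arcs_in U.
Proof.
case/denseP=> W [WU /set0Pn[x xW] degW]; apply: leq_trans (arcs_inS WU).
rewrite arcs_inE; apply: (@leq_trans (#|W| * k)).
  by rewrite leq_mul2r (leq_ltn_trans (degW x xW) (deg_in_lt xW)) orbT.
by rewrite -sum_nat_const; apply: leq_sum.
Qed.

Lemma clique_of_deg W k : #|W| = k.+1 -> {in W, forall x, k <= deg_in W x} -> clique W.
Proof.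
move=> Wk degW x y xW yW xNy.
have : [set z in W | adj x z] == W :\ x.
  rewrite eqEcard; apply/andP; split.
    apply/subsetP=> z; rewrite !inE => /andP[-> xz]; rewrite andbT.
    by apply: contraTneq xz => ->; rewrite adj_irrefl.
  have := degW x xW; rewrite /deg_in; apply: leq_trans.
  by have := cardsD1 x W; rewrite xW Wk; lia.
by move/eqP/setP/(_ y); rewrite !inE yW eq_sym xNy /= => ->.
Qed.

(** Equality in [dense_arcs]: cancelling [k > 0] forces [k + 1] vertices, so degrees at least [k]
    make [W] a clique, and an arc of [U] not inside [W] would push the count over the bound. *)
Lemma dense_arcs_eq U k : 0 < k -> dense U k -> arcs_in U <= k.+1 * k ->
  exists W, [/\ W \subset U, #|W| = k.+1, clique W &
    {in U &, forall x y, adj x y -> (x \in W) && (y \in W)}].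
Proof.
move=> k0 /denseP[W [WU /set0Pn[x xW] degW]] le; exists W.
have Wk : k.+1 * k <= #|W| * k.
  by rewrite leq_mul2r (leq_ltn_trans (degW x xW) (deg_in_lt xW)) orbT.
have Warcs : #|W| * k <= arcs_in W.
  by rewrite arcs_inE -sum_nat_const; apply: leq_sum.
have cW : #|W| = k.+1.
  apply/eqP; rewrite -(eqn_pmul2r k0) eqn_leq Wk andbT.
  exact: leq_trans Warcs (leq_trans (arcs_inS WU) le).
split=> //; first exact: clique_of_deg degW.
move=> u v uU vU uv; apply: contraLR le => nW; rewrite -ltnNge.
apply: (@leq_trans (arcs_in W + arcs (fun a b => [&& a \in U, b \in U & ~~ ((a \in W) && (b \in W))]))).
  rewrite -addn1; apply: leq_add; first exact: leq_trans Warcs.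
  by apply: ltnW; apply: (arcs_pair uv); rewrite ?uU ?vU /= ?[(v \in W) && _]andbC.
apply: arcsU => a b _; first by move=> /andP[-> ->]; rewrite !andbF.
case/orP=> [/andP[aW bW]|/and3P[-> ->] //].
by rewrite !(subsetP WU).
Qed.

(** Take [p] least such that [dense U p] fails: greedy colouring then succeeds with [p] colours,
    while a core of minimum degree [p - 1] still exists. *)
Lemma degeneracy U : exists p, colors_in U p /\ (0 < p -> dense U p.-1).
Proof.
have ex : exists p, ~~ dense U p.
  exists #|G|; apply/denseP=> -[W [WU /set0Pn[x xW] degW]].
  have := leq_trans (leq_ltn_trans (degW x xW) (deg_in_lt xW)) (max_card _).
  by rewrite ltnn.
case: (ex_minnP ex) => p np minp; exists p; split.
  by case: (dense_or_colors U p) np => // ->.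
move=> p0; apply: contraTT p0 => /minp; by case: p {np minp} => // p; rewrite ltnn.
Qed.

(** Colouring the two sides with disjoint palettes takes [p + q > k] colours, and a side that is
    given [p] of them has a core with at least [p * (p - 1)] arcs. *)
Lemma arcs_in_setC A k : ~ colors_in [set: G] k ->
  k.+1 * k.-1 <= 2 * (arcs_in A + arcs_in (~: A)).
Proof.
move=> nk; have [p [cp dp]] := degeneracy A; have [q [cq dq]] := degeneracy (~: A).
have kpq : k < p + q.
  rewrite ltnNge; apply/negP=> pqk; apply: nk; apply: colors_in_leq pqk _.
  by rewrite -(setUCr A); apply: colors_inU.
have ap : p * p.-1 <= arcs_in A.
  by case: p dp {cp kpq} => // p /(_ isT) /dense_arcs.
have aq : q * q.-1 <= arcs_in (~: A).
  by case: q dq {cq kpq} => // q /(_ isT) /dense_arcs.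
by have := split_bound kpq; lia.
Qed.

(* An optimal colouring of each side that uses only its clique must clash
   across, otherwise one colour could be saved. *)
Lemma cliques_join A P N p q : P \subset A -> N \subset ~: A ->
  {in A &, forall x y, adj x y -> (x \in P) && (y \in P)} ->
  {in ~: A &, forall x y, adj x y -> (x \in N) && (y \in N)} ->
  #|P| = p.+2 -> #|N| = q.+2 -> ~ colors_in [set: G] (p + q).+3 ->
  {in P & N, forall x y, adj x y}.
Proof.
move=> PA NA Padj Nadj cP cN nk a b aP bN.
apply: contra_notT nk => ab.
(* The palettes of the two sides overlap in the single colour [p + 1]: [a], placed last, and [b],
   placed first, share it. *)
pose LP := rcons (enum (P :\ a)) a; pose LN := b :: enum (N :\ b).
have memLP x : (x \in LP) = (x \in P).
  by rewrite mem_rcons inE mem_enum !inE; case: eqVneq => // ->.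
have memLN x : (x \in LN) = (x \in N).
  by rewrite inE mem_enum !inE; case: eqVneq => // ->.
have sP : size (enum (P :\ a)) = p.+1.
  by rewrite -cardE; have := cardsD1 a P; rewrite aP cP; lia.
have sLN : size LN = q.+2.
  by rewrite /= -cardE; have := cardsD1 b N; rewrite bN cN; lia.
have sLP : size LP = p.+2 by rewrite size_rcons sP.
have inLP x : x \in P -> index x LP < p.+2 by rewrite -memLP -sLP index_mem.
have inLN x : x \in N -> index x LN < q.+2 by rewrite -memLN -sLN index_mem.
have idx_a x : x \in P -> p < index x LP -> x = a.
  move=> xP px; have := nth_index a (_ : x \in LP); rewrite memLP => <- //.
  have -> : index x LP = p.+1 by have := inLP x xP; lia.
  by rewrite nth_rcons sP ltnn eqxx.
(* Vertices outside the cliques have no neighbours on their own side; the extreme colours [0] and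
   [p + q + 2] keep them away from the shared colour. *)
pose cl x := if x \in A then (if x \in P then index x LP else 0)
             else p.+1 + (if x \in N then index x LN else q.+1).
exists cl; split=> [x _|].
  rewrite /cl; case: ifP => _; case: ifP => [xS|_]; try lia.
    by have := inLP x xS; lia.
  by have := inLN x xS; lia.
have cross x y : x \in A -> y \notin A -> adj x y -> cl x != cl y.
  move=> xA yA xy; rewrite /cl xA (negPf yA).
  case: ifPn => xP; last by rewrite neq_ltn addSn.
  apply/eqP => E.
  have xa : x = a by apply: idx_a => //; lia.
  have := inLP x xP; move: E; case: ifPn => yN E lt; last by lia.
  have : index y LN = 0 by lia.
  rewrite /=; case: eqVneq => // by_ _.
  by rewrite xa -by_ (negPf ab) in xy.
move=> x y _ _ xy.
have [xA|xA] := boolP (x \in A); have [yA|yA] := boolP (y \in A).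
- have /andP[xP yP] := Padj x y xA yA xy.
  rewrite /cl xA yA xP yP; apply: contraTneq xy => E.
  have -> : x = y by apply: (index_inj x _ _ E); rewrite memLP.
  by rewrite adj_irrefl.
- exact: cross.
- by rewrite eq_sym; apply: cross; rewrite // adj_sym.
- have /andP[xN yN] : (x \in N) && (y \in N) by apply: Nadj; rewrite // inE.
  rewrite /cl (negPf xA) (negPf yA) xN yN eqn_add2l; apply: contraTneq xy => E.
  have -> : x = y by apply: (index_inj x _ _ E); rewrite memLN.
  by rewrite adj_irrefl.
Qed.

(** Swapping the ends pairs the arcs increasing for [enum_rank] with the others. This parity later
    turns a deficit smaller than 4 into an exact equality. *)
Lemma arcs_in_even U : exists a, arcs_in U = 2 * a.
Proof.
pose S := [set p : G * G | adj p.1 p.2 && ((p.1 \in U) && (p.2 \in U))].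
pose L := [set p : G * G | enum_rank p.1 < enum_rank p.2].
exists #|S :&: L|; rewrite /arcs_in /arcs -/S -(cardsID L) mul2n -addnn; congr addn.
pose swap (p : G * G) := (p.2, p.1).
have swapI : injective swap by move=> [? ?] [? ?] [-> ->].
rewrite -(card_imset (S :&: L) swapI); apply: eq_card => -[x y]; apply/idP/imsetP.
  rewrite !inE /= -leqNgt => /andP[yx /and3P[xy xU yU]]; exists (y, x) => //.
  rewrite !inE /= adj_sym xy xU yU /= ltn_neqAle yx andbT.
  by apply: contraTneq xy => /val_inj/enum_rank_inj->; rewrite adj_irrefl.
case=> -[u v]; rewrite !inE /= => /andP[/and3P[uv uU vU] lt] [-> ->].
by rewrite adj_sym uv uU vU -leqNgt ltnW.
Qed.

(** Were the gain of 4 missing, the split would be balanced and, by parity, each side would have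
    exactly [p * (p - 1)], resp. [q * (q - 1)], arcs, hence be a clique plus isolated vertices. By
    [cliques_join] the two cliques then form one on [p + q = k + 1] vertices. *)
Lemma arcs_in_setC_clique_free A k : 2 < k -> ~ colors_in [set: G] k ->
  (forall W, #|W| = k.+1 -> ~ clique W) ->
  k.+1 * k.-1 + 4 <= 2 * (arcs_in A + arcs_in (~: A)).
Proof.
move=> k3 nk noclique.
have [p [cp dp]] := degeneracy A; have [q [cq dq]] := degeneracy (~: A).
have kpq : k < p + q.
  rewrite ltnNge; apply/negP=> pqk; apply: nk; apply: colors_in_leq pqk _.
  by rewrite -(setUCr A); apply: colors_inU.
have ap : p * p.-1 <= arcs_in A.
  by case: p dp {cp kpq} => // p /(_ isT) /dense_arcs.
have aq : q * q.-1 <= arcs_in (~: A).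
  by case: q dq {cq kpq} => // q /(_ isT) /dense_arcs.
rewrite leqNgt; apply/negP => lt.
have [a Ea] := arcs_in_even A; have [b Eb] := arcs_in_even (~: A).
rewrite Ea Eb in lt ap aq.
have bnd := split_bound kpq.
have bal : ~~ [|| k.+1 < p + q, p <= 1 | q <= 1].
  by apply/negP=> unb; have := split_bound_unbalanced k3 kpq unb; lia.
have evpp n : exists c, n * n.-1 = 2 * c.
  exists 'C(n, 2); have := bin_ffact n 2; rewrite ffactnS ffactn1 (_ : 2`! = 2) //; lia.
have [c Ec] := evpp p; have [d Ed] := evpp q.
have [P [PA cP clP Padj]] : exists W, [/\ W \subset A, #|W| = p.-1.+1, clique W &
    {in A &, forall x y, adj x y -> (x \in W) && (y \in W)}].
  by apply: dense_arcs_eq; [lia|apply: dp; lia|rewrite Ea prednK; lia].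
have [N [NA cN clN Nadj]] : exists W, [/\ W \subset ~: A, #|W| = q.-1.+1, clique W &
    {in ~: A &, forall x y, adj x y -> (x \in W) && (y \in W)}].
  by apply: dense_arcs_eq; [lia|apply: dq; lia|rewrite Eb prednK; lia].
have PN : {in P & N, forall x y, adj x y}.
  apply: (@cliques_join A P N p.-2 q.-2) => //; [lia|lia|].
  by rewrite (_ : _.+3 = k) //; lia.
have disj : [disjoint P & N].
  by rewrite disjoints_subset; apply: subset_trans PA _; rewrite -setCS setCK.
apply: (noclique (P :|: N)).
  by rewrite cardsU disjoint_setI0 // cards0; lia.
move=> x y; rewrite !inE => /orP[] xU /orP[] yU xy.
- exact: clP.
- exact: PN.
- by rewrite adj_sym; apply: PN.
- exact: clN.
Qed.

(** Meant for the positive and negative vertices of an eigenvector when the cut bound is tight: the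
    zero vertices must then carry many arcs. *)
Lemma separating_arcs P N k : 1 < k -> ~ colors_in [set: G] k -> [disjoint P & N] ->
  {in P &, forall x y, ~~ adj x y} -> {in N &, forall x y, ~~ adj x y} ->
  k * k.-1 + 2 <= arcs (fun x y => (x \notin P :|: N) || (y \notin P :|: N)).
Proof.
move=> k2 nk disj indP indN.
have ind1 (Q : {set G}) : {in Q &, forall x y, ~~ adj x y} -> colors_in Q 1.
  move=> indQ; exists (fun=> 0); split=> // x y xQ yQ xy.
  by have := indQ x y xQ yQ; rewrite xy.
pose Z := ~: (P :|: N).
(* Removing the independent set [S] saves one colour only, so its complement still has [k * (k - 1)]
   arcs, all meeting [Z] because [Q] is independent; the edge from [z] to [s] adds two more. *)
have side (Q S : {set G}) z s : P :|: N = Q :|: S -> [disjoint Q & S] ->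
    {in Q &, forall x y, ~~ adj x y} -> {in S &, forall x y, ~~ adj x y} ->
    z \in Z -> s \in S -> adj z s ->
    k * k.-1 + 2 <= arcs (fun x y => (x \notin P :|: N) || (y \notin P :|: N)).
  rewrite /Z => -> QS indQ indS zZ sS zs.
  have dens : dense (~: S) k.-1.
    case: (dense_or_colors (~: S) k.-1) => // cS; case: nk.
    rewrite -(setUCr S) -(prednK (ltnW k2)) -add1n.
    by apply: colors_inU => //; apply: ind1.
  apply: (@leq_trans (arcs_in (~: S) + arcs (fun x y =>
      (x \notin Q :|: S) && (y \in S) || (y \notin Q :|: S) && (x \in S)))).
    apply: leq_add; first by have := dense_arcs dens; rewrite prednK // ltnW.
    by rewrite inE in zZ; apply: (arcs_pair zs); rewrite /= zZ sS ?orbT.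
  apply: arcsU => x y xy.
    by rewrite !inE => /andP[/negPf-> /negPf->]; rewrite !andbF.
  case/orP=> [|/orP[]/andP[-> _] //]; last by rewrite orbT.
  rewrite !inE => /andP[/negPf xS /negPf yS]; rewrite xS yS !orbF -negb_and.
  by apply: contraL xy => /andP[]; apply: indQ.
have [/existsP[[z s] /and3P[/= zZ sPN zs]]|/existsPn noarc] :=
    boolP [exists p : G * G, [&& p.1 \in Z, p.2 \in P :|: N & adj p.1 p.2]].
  case/setUP: sPN => [sP|sN]; last exact: (side P N z s).
  by apply: (side N P z s) => //; rewrite ?[N :|: P]setUC // disjoint_sym.
(* No edge joins [Z] to the rest, so [P] and [N] can reuse two of the colours of [Z]; hence [Z]
   itself is not [k]-colourable. *)
have dens : dense Z k.
  case: (dense_or_colors Z k) => // -[c [ck cp]]; case: nk.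
  exists (fun x => if x \in Z then c x else x \in P : nat).
  split=> [x _|x y _ _ xy]; first by case: ifP => [/ck //|_]; case: (x \in P); lia.
  have crossN u v : u \in Z -> v \notin Z -> ~~ adj u v.
    by move=> uZ vZ; have := noarc (u, v); rewrite /= uZ -(setCK (P :|: N)) inE -/Z vZ.
  have [xZ|xZ] := boolP (x \in Z); have [yZ|yZ] := boolP (y \in Z).
  - exact: cp.
  - by rewrite (negPf (crossN x y xZ yZ)) in xy.
  - by rewrite adj_sym (negPf (crossN y x yZ xZ)) in xy.
  move: xZ yZ; rewrite !inE !negbK.
  have [xP _|xP /= xN] := boolP (x \in P); have [yP _|yP /= yN] := boolP (y \in P) => //.
  - by rewrite (negPf (indP x y xP yP)) in xy.
  - by rewrite (negPf (indN x y xN yN)) in xy.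
apply: (@leq_trans (k.+1 * k)); first by case: k k2 {nk side dens} => [|[|k]] //= _; nia.
apply: leq_trans (dense_arcs dens) _; apply: arcs_sub => x y _.
by rewrite !inE => /andP[-> _].
Qed.

(* A triangle-free graph of minimum degree two on four vertices is a 4-cycle. *)
Lemma gsize_triangle_free : ~ colors_in [set: G] 2 ->
  (forall W, #|W| = 3 -> ~ clique W) -> 4 < gsize G.
Proof.
move=> n2 noclique; rewrite ltnNge; apply/negP => m4; apply: n2.
case: (dense_or_colors [set: G] 2) => // /denseP[W [_ /set0Pn[w wW] degW]].
have arcsW : arcs_in W <= 8.
  apply: leq_trans (_ : 2 * gsize G <= 8); last by lia.
  by rewrite -arcs_gsize; apply: arcs_sub.
have W2 : #|W| * 2 <= arcs_in W by rewrite arcs_inE -sum_nat_const; apply: leq_sum.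
have W3 : 2 < #|W| := leq_ltn_trans (degW w wW) (deg_in_lt wW).
have W4 : #|W| = 4.
  have : #|W| <> 3 by move=> E; apply: (noclique W E); apply: clique_of_deg E degW.
  by lia.
have arcs_inW x y : adj x y -> (x \in W) && (y \in W).
  move=> xy; apply: contraLR m4 => nW; rewrite -ltnNge -(ltn_pmul2l (isT : 0 < 2)) -arcs_gsize.
  apply: (@leq_trans (arcs_in W + arcs (fun a b => ~~ ((a \in W) && (b \in W))))).
    rewrite -addn1; apply: leq_add; first by rewrite W4 in W2.
    by apply: ltnW; apply: (arcs_pair xy); rewrite // andbC.
  by apply: arcsU => a b _ // ->.
(* A third neighbour would give at least [3 + 3 * 2 = 9] arcs in [W], against 8. *)
have degw : deg_in W w = 2.
  apply/eqP; rewrite eqn_leq degW // andbT leqNgt; apply/negP => lt.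
  have : #|W :\ w| * 2 <= \sum_(x in W :\ w) deg_in W x.
    by rewrite -sum_nat_const; apply: leq_sum => x; rewrite !inE => /andP[_]; apply: degW.
  have := arcs_inE W; rewrite (big_setD1 w) //=.
  by have := cardsD1 w W; rewrite wW W4; lia.
pose N := [set y in W | adj w y].
have NW : N \subset W by apply/subsetP=> y; rewrite inE => /andP[].
(* Adjacent vertices in [N] form a triangle with [w]; adjacent vertices outside [N] would, with [w],
   be three elements of the two-element set [W :\: N]. *)
exists (fun x => x \in N : nat); split=> [x _|x y _ _ xy]; first by case: (x \in N).
have /andP[xW yW] := arcs_inW x y xy.
have xNy : x != y by apply: contraTneq xy => ->; rewrite adj_irrefl.
have [xN|xN] := boolP (x \in N); have [yN|yN] := boolP (y \in N) => //.
  move: xN yN; rewrite !inE xW yW /= => wx wy; case: (noclique [set w; x; y]).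
    have wNx : w != x by apply: contraTneq wx => ->; rewrite adj_irrefl.
    have wNy : w != y by apply: contraTneq wy => ->; rewrite adj_irrefl.
    rewrite setUC cardsU1 cards2 !inE negb_or [y == w]eq_sym [y == x]eq_sym.
    by rewrite xNy wNx wNy.
  move=> u v; rewrite !inE -!orbA.
  by do 2![case/or3P => /eqP ->]; rewrite ?eqxx // => _; rewrite // adj_sym.
have cWN : #|W :\: N| = 2.
  by rewrite cardsD (setIidPr NW) W4 -[#|N|]/(deg_in W w) degw.
have wx : w != x by apply: contraNneq yN => wx; rewrite inE yW wx.
have wy : w != y by apply: contraNneq xN => wy; rewrite inE xW wy adj_sym.
have : [set w; x; y] \subset W :\: N.
  apply/subsetP=> z; rewrite !inE -!orbA => /or3P[]/eqP->; rewrite ?wW ?adj_irrefl //=.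
    by move: xN; rewrite inE xW => ->.
  by move: yN; rewrite inE yW => ->.
move/subset_leq_card; rewrite cWN setUC cardsU1 cards2 !inE negb_or.
by rewrite [y == w]eq_sym [y == x]eq_sym wx wy xNy.
Qed.
End Colouring.

Local Open Scope ring_scope.

(** * Rayleigh quotients *)

(** Diagonalise over the complex closure: the eigenvalues are real with sum [\tr A = 0], so if none
    were negative all would vanish and [A] would be zero. *)
Lemma symmetric_neg_eigenvalue (R : rcfType) (n : nat) (A : 'M[R]_n) :
  A^T = A -> \tr A = 0 -> A != 0 -> exists2 mu, mu < 0 & eigenvalue A mu.
Proof.
move=> symA trA nzA.
pose f := real_complex R.
pose B := map_mx f A.
have BA i j : B i j = (A i j)%:C%C by rewrite mxE.
have Bherm : B \is hermsymmx.
  apply: realsym_hermsym.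
    apply/is_hermitianmxP; rewrite expr0 scale1r map_mx_id //.
    by apply/matrixP => i j; rewrite [RHS]mxE [RHS]mxE !BA -{1}symA mxE.
  by apply/mxOverP => i j; rewrite BA complex_real.
have /orthomx_spectralP := hermitian_normalmx Bherm.
set P := spectralmx B; set d := spectral_diag B => Bspec.
have dreal i : d 0 i \is Num.real.
  by have /mxOverP := hermitian_spectral_diag_real Bherm; apply.
have Pu : P \in unitmx := spectral_unit B.
have eig i : eigenvalue A (complex.Re (d 0 i)).
  rewrite eigenvalue_root_char -(fmorph_root f) map_char_poly -/B /= RRe_real //.
  rewrite -eigenvalue_root_char; apply/eigenvalueP.
  exists (row i P); last first.
    apply: contraTneq Pu => r0; rewrite -row_free_unit.
    apply/negP=> /row_freeP[Q PQ]; have := congr1 (row i) PQ.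
    rewrite row_mul r0 mul0mx row1 => /rowP/(_ i).
    by rewrite !mxE !eqxx => /esym/eqP; rewrite pnatr_eq0.
  rewrite {1}Bspec -row_mul !mulmxA mulmxV // mul1mx row_mul row_diag_mx.
  by rewrite -scalemxAl -rowE.
have [/existsP[i di]|/existsPn dge0] := boolP [exists i, complex.Re (d 0 i) < 0].
  by exists (complex.Re (d 0 i)).
have d0 i : d 0 i = 0.
  have : \sum_i complex.Re (d 0 i) = 0.
    have : \tr B = \sum_i d 0 i.
      by rewrite Bspec mxtrace_mulC mulmxA mulmxV // mul1mx mxtrace_diag.
    have -> : \tr B = (\tr A)%:C%C.
      by rewrite /mxtrace (raddf_sum (real_complex R)); apply: eq_bigr => k _; rewrite BA.
    by rewrite trA => /(congr1 (@complex.Re R)); rewrite raddf_sum.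
  move/psumr_eq0P => dz; rewrite -(RRe_real (dreal i)) dz // => j _.
  by have := dge0 j; rewrite -leNgt.
have B0 : B = 0.
  rewrite Bspec (_ : diag_mx d = 0) ?mulmx0 ?mul0mx //.
  by apply/matrixP => i j; rewrite !mxE d0 mul0rn.
case/eqP: nzA; apply/matrixP => i j; have := BA i j.
by rewrite B0 !mxE => /(congr1 (@complex.Re R)) /= <-.
Qed.

Section Rayleigh.
Variables (R : realFieldType) (G : sgraph).
Implicit Types (x f g : G -> R) (mu theta : R).

Lemma sum2_arcs (D : rel G) : \sum_i \sum_j ((adj i j && D i j)%:R : R) = (arcs D)%:R.
Proof.
rewrite /arcs (card_pairs (fun i j => adj i j && D i j)) natr_sum; apply: eq_bigr => i _.
by rewrite -sum1dep_card natr_sum [RHS]big_mkcond; apply: eq_bigr => j _; case: (_ && _).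
Qed.

(* [sgsq x i * sgsq x j] is [+- x_i^2 x_j^2], with the sign of [x_i x_j]. *)
Definition sgsq x i := x i * `|x i|.

Lemma sgsq_bound x i : `|sgsq x i| = x i ^+ 2.
Proof. by rewrite normrM normr_id -expr2 real_normK ?num_real. Qed.

Lemma sgsqM x i j :
  sgsq x i * sgsq x j = if x i * x j < 0 then - (x i ^+ 2 * x j ^+ 2) else x i ^+ 2 * x j ^+ 2.
Proof.
rewrite /sgsq mulrACA -normrM; case: ltrP => h.
  by rewrite ltr0_norm //; ring.
by rewrite ger0_norm //; ring.
Qed.

(** Weighted AM-GM for [t = x i * x j < 0], tight when [theta * t = -1]. The bracket with [sgsq] is
    [2 * t^2] there and vanishes for [t >= 0], so only opposite signs are charged. *)
Lemma arc_bound x theta (a : bool) i j : 0 < theta ->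
  - (a%:R * (x i * x j)) <= theta / 4 * (x i ^+ 2 * x j ^+ 2 - sgsq x i * sgsq x j)
     + (a && (x i * x j < 0))%:R / (2 * theta).
Proof.
move=> t0; rewrite sgsqM; case: a; case: ltrP => h;
  rewrite ?mul0r ?mul1r ?subrr ?mulr0 ?addr0 ?oppr0 //=.
- have -> : theta / 4 * (x i ^+ 2 * x j ^+ 2 - - (x i ^+ 2 * x j ^+ 2)) + (2 * theta)^-1 =
     (2 * theta)^-1 * ((theta * (x i * x j)) ^+ 2 + 1) by field; lra.
  rewrite -subr_ge0 [X in 0 <= X](_ : _ = (2 * theta)^-1 * (theta * (x i * x j) + 1) ^+ 2);
    last by field; lra.
  by apply: mulr_ge0; rewrite ?sqr_ge0 // invr_ge0; lra.
- by rewrite oppr_le0.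
- by apply: mulr_ge0; [lra|have := sqr_ge0 (x i * x j); nra].
Qed.

Variables (x : G -> R) (mu : R).
Hypothesis mu_gt0 : 0 < mu.
Hypothesis norm1 : \sum_i x i ^+ 2 = 1.
Hypothesis energy : \sum_i \sum_j (adj i j)%:R * (x i * x j) = - mu.

Let neg_arcs := arcs (fun i j => x i * x j < 0).

(** The gap in [arc_bound] at [theta = 2 * mu]. *)
Let slack i j := mu / 2 * (x i ^+ 2 * x j ^+ 2 - sgsq x i * sgsq x j)
     + (adj i j && (x i * x j < 0))%:R / (4 * mu) + (adj i j)%:R * (x i * x j).

Let slack_ge0 i j : 0 <= slack i j.
Proof.
have := @arc_bound x (2 * mu) (adj i j) i j; rewrite /slack.
have -> : 2 * mu / 4 = mu / 2 by field.
have -> : 2 * (2 * mu) = 4 * mu by ring.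
by move=> /(_ (mulr_gt0 (ltr0Sn _ 1) mu_gt0)); rewrite -subr_ge0 opprK.
Qed.

Let slack_sum : \sum_i \sum_j slack i j =
  mu / 2 * (1 - (\sum_i sgsq x i) ^+ 2) + neg_arcs%:R / (4 * mu) - mu.
Proof.
rewrite /slack; under eq_bigr => i _ do rewrite !big_split /= -mulr_suml -mulr_sumr sumrB.
rewrite !big_split /= -mulr_suml -mulr_sumr sumrB -!big_distrlr /= norm1 sum2_arcs energy.
by rewrite mul1r expr2.
Qed.

(** Summing [arc_bound] over all pairs gives [mu <= mu / 2 + neg_arcs / (4 * mu)], after dropping
    the square of the sum of the [sgsq x i]. *)
Lemma eigenvalue_le_neg_arcs : 2 * mu ^+ 2 <= neg_arcs%:R.
Proof.
have mu0 := mu_gt0.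
have : 0 <= \sum_i \sum_j slack i j by apply: sumr_ge0 => i _; apply: sumr_ge0.
rewrite slack_sum; have : 0 <= mu / 2 * (\sum_i sgsq x i) ^+ 2.
  by apply: mulr_ge0; [lra|exact: sqr_ge0].
move=> h1 h2; have : mu / 2 <= neg_arcs%:R / (4 * mu) by lra.
by rewrite ler_pdivlMr; lra.
Qed.

(** Equality makes every [slack] vanish, but it is positive at an arc with [x i * x j > 0] and at a
    non-adjacent pair of opposite signs. *)
Lemma eigenvalue_eq_neg_arcs i j : neg_arcs%:R <= 2 * mu ^+ 2 ->
  (adj i j -> x i * x j <= 0) /\ (x i * x j < 0 -> adj i j).
Proof.
have mu0 := mu_gt0.
move=> le; have sl0 : slack i j = 0.
  have : \sum_i \sum_j slack i j <= 0.
    rewrite slack_sum; have : 0 <= mu / 2 * (\sum_i sgsq x i) ^+ 2.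
      by apply: mulr_ge0; [lra|exact: sqr_ge0].
    have : neg_arcs%:R / (4 * mu) <= mu / 2 by rewrite ler_pdivrMr; lra.
    lra.
  move=> s0; apply/eqP; rewrite eq_le slack_ge0 andbT; apply: le_trans s0.
  rewrite (bigD1 i) //= (bigD1 j) //= -addrA lerDl.
  apply: addr_ge0; first exact: sumr_ge0.
  by apply: sumr_ge0 => k _; apply: sumr_ge0.
move: sl0; rewrite /slack sgsqM; case: (adj i j); case: ltrP => h //= sl0; split=> // _.
- by rewrite ltW.
- by move: sl0; rewrite subrr mulr0 mul0r !add0r mul1r => ->.
- have : 0 < x i ^+ 2 * x j ^+ 2 by rewrite -exprMn exprn_even_gt0 //= lt_eqF.
  by move=> /(mulr_gt0 mu0); rewrite !mul0r !addr0 in sl0 *; lra.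
Qed.

(* On [W] the adjacency form is [(sum x_i)^2 - sum x_i^2] minus the form of the
   complement, which is at most [z sum x_i^2].  The other arcs only matter when
   [x_i x_j < 0]; there [arc_bound] is used with [theta = mu / K], and the sum of
   [x_i^2 x_j^2] over these pairs is at most [2 K (1 - K)]. *)
Lemma eigenvalue_le_dense (W : {set G}) (z : nat) :
  {in W, forall i, (#|[set j in W | (j != i) && ~~ adj i j]| <= z)%N} ->
  2 * mu ^+ 2 <= 2 * (1 + z%:R) * mu + (arcs (fun i j => ~~ ((i \in W) && (j \in W))))%:R.
Proof.
have mu0 := mu_gt0.
move=> degW; pose w i : R := (i \in W)%:R.
pose kappa := \sum_i w i * x i ^+ 2.
pose tau := \sum_i sgsq x i; pose tauW := \sum_i w i * sgsq x i.
set m' := arcs _.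
have w01 i : 0 <= w i <= 1 by rewrite /w; case: (i \in W); rewrite ?lexx ?ler01.
have kappa0 : 0 <= kappa.
  by apply: sumr_ge0 => i _; have := w01 i; have := sqr_ge0 (x i); nra.
have kappa1 : kappa <= 1.
  by rewrite -norm1; apply: ler_sum => i _; have := w01 i; have := sqr_ge0 (x i); nra.
have tauW_le : `|tauW| <= kappa.
  apply: le_trans (ler_norm_sum _ _ _) _; apply: ler_sum => i _.
  by rewrite normrM sgsq_bound ger0_norm //; case/andP: (w01 i).
have tau_le : `|tau - tauW| <= 1 - kappa.
  rewrite -norm1 -!sumrB; apply: le_trans (ler_norm_sum _ _ _) _; apply: ler_sum => i _.
  have -> : sgsq x i - w i * sgsq x i = (1 - w i) * sgsq x i by ring.
  have -> : x i ^+ 2 - w i * x i ^+ 2 = (1 - w i) * x i ^+ 2 by ring.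
  by rewrite normrM sgsq_bound ger0_norm //; have := w01 i; lra.
(* [4 * K * (1 - K)] decreases for [K >= 1 / 2]; below that [kappa] is replaced by [1 / 2], where
   the bound is the trivial 1. *)
pose K : R := Num.max kappa (1 / 2).
have K0 : 0 < K by rewrite lt_max; apply/orP; right; lra.
have [kK K1] : kappa <= K /\ K <= 1 by rewrite le_max lexx ge_max kappa1; split=> //=; lra.
(* The left side is twice the sum of [x_i^2 x_j^2] over the pairs of opposite signs not both in
   [W]. *)
have disp : 1 - tau ^+ 2 - kappa ^+ 2 + tauW ^+ 2 <= 4 * K * (1 - K).
  have [tW1 tW2] : - kappa <= tauW /\ tauW <= kappa by move: tauW_le; rewrite ler_norml => /andP.
  have [t1 t2] : - (1 - kappa) <= tau - tauW /\ tau - tauW <= 1 - kappa.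
    by move: tau_le; rewrite ler_norml => /andP.
  have tW2k : tauW ^+ 2 <= kappa ^+ 2 by nra.
  rewrite /K; case: (lerP kappa (1 / 2)) => kh; first by have := sqr_ge0 tau; nra.
  pose d := tau - tauW; have -> : tau = tauW + d by rewrite /d; ring.
  rewrite -/d in t1 t2.
  have : 0 <= (1 - kappa - d) * (2 * kappa - (1 - kappa) - d) by apply: mulr_ge0; lra.
  have : 0 <= (1 - kappa + d) * (2 * kappa - (1 - kappa) + d) by apply: mulr_ge0; lra.
  have [d0|d0] := lerP 0 d; nra.
pose theta := mu / K.
have theta0 : 0 < theta by apply: divr_gt0.
pose na (i j : G) : R := ((j != i) && ~~ adj i j)%:R.
(* The first two lines bound a pair inside [W] through the complement, non-edges costing
   [(x_i^2 + x_j^2) / 2]; the rest is [arc_bound] with the pairs inside [W] taken out. *)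
pose rhs (i j : G) := w i * w j * (na i j * (x i ^+ 2 + x j ^+ 2) / 2)
  + w i * w j * ((i == j)%:R * (x i * x j))
  - (w i * x i) * (w j * x j)
  + (theta / 4 * ((x i ^+ 2 * x j ^+ 2 - sgsq x i * sgsq x j)
     - ((w i * x i ^+ 2) * (w j * x j ^+ 2) - (w i * sgsq x i) * (w j * sgsq x j)))
  + (adj i j && ~~ ((i \in W) && (j \in W)))%:R / (2 * theta)).
have le_out i j : - ((adj i j)%:R * (x i * x j)) <=
    theta / 4 * (x i ^+ 2 * x j ^+ 2 - sgsq x i * sgsq x j) + (adj i j)%:R / (2 * theta).
  apply: le_trans (@arc_bound x theta (adj i j) i j theta0) _.
  by rewrite lerD2l ler_pM2r ?invr_gt0 ?ler_nat; [case: (adj i j); case: ltrP|lra].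
have le_rhs i j : - ((adj i j)%:R * (x i * x j)) <= rhs i j.
  rewrite /rhs /w; case: (i \in W); case: (j \in W); rewrite /= ?andbT ?andbF.
  - rewrite /na; case: eqVneq => [->|ij] /=; first by rewrite adj_irrefl /=; lra.
    by have := sqr_ge0 (x i - x j); case: (adj i j) => /=; lra.
  - by have := le_out i j; lra.
  - by have := le_out i j; lra.
  - by have := le_out i j; lra.
have : mu <= \sum_i \sum_j rhs i j.
  rewrite -[mu]opprK -energy -sumrN; apply: ler_sum => i _.
  by rewrite -sumrN; apply: ler_sum.
have -> : \sum_i \sum_j rhs i j =
   \sum_i \sum_j w i * w j * (na i j * (x i ^+ 2 + x j ^+ 2) / 2)
   + kappa - (\sum_i w i * x i) ^+ 2
   + (theta / 4 * ((1 - tau ^+ 2) - (kappa ^+ 2 - tauW ^+ 2)) + m'%:R / (2 * theta)).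
  rewrite /rhs; under eq_bigr => i _ do
    rewrite !(big_split, sumrB) /= -mulr_suml -mulr_sumr !sumrB.
  rewrite !(big_split, sumrB) /= -mulr_suml -mulr_sumr !sumrB -!big_distrlr /= norm1 sum2_arcs mul1r !expr2.
  congr (_ + _ + _ + _); last first.
    by rewrite big_distrlr /= -sumrN; apply: eq_bigr => i _; rewrite -sumrN.
  apply: eq_bigr => i _; rewrite (bigD1 i) //= big1 ?addr0.
    by rewrite eqxx mul1r /w; case: (i \in W); rewrite ?mul1r ?mul0r ?expr2.
  by move=> j ji; rewrite eq_sym (negPf ji) mul0r mulr0.
have na_sum : \sum_i \sum_j w i * w j * (na i j * (x i ^+ 2 + x j ^+ 2) / 2) <= z%:R * kappa.
  have -> : \sum_i \sum_j w i * w j * (na i j * (x i ^+ 2 + x j ^+ 2) / 2) =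
     \sum_i (w i * x i ^+ 2) * \sum_j w j * na i j.
    have -> : \sum_i \sum_j w i * w j * (na i j * (x i ^+ 2 + x j ^+ 2) / 2) =
      (\sum_i \sum_j (w i * x i ^+ 2) * (w j * na i j)) / 2
      + (\sum_i \sum_j (w i * x i ^+ 2) * (w j * na i j)) / 2.
      rewrite [X in _ = _ + X / 2]exchange_big -mulrDl -big_split mulr_suml; apply: eq_bigr => i _ /=.
      rewrite -big_split mulr_suml; apply: eq_bigr => j _ /=.
      by rewrite /na [j == i]eq_sym [adj j i]adj_sym; ring.
    by rewrite -splitr; apply: eq_bigr => i _; rewrite mulr_sumr.
  rewrite mulr_sumr; apply: ler_sum => i _; rewrite mulrC /w.
  have [iW|] := boolP (i \in W); last by rewrite mul0r !mulr0.
  rewrite mul1r ler_wpM2r ?sqr_ge0 //.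
  apply: le_trans (_ : (#|[set j in W | (j != i) && ~~ adj i j]|)%:R <= _);
    last by rewrite ler_nat degW.
  rewrite -sum1dep_card natr_sum [X in _ <= X]big_mkcond; apply: ler_sum => j _.
  by rewrite -mulrb -natrM mulnb; case: (_ && _).
have := sqr_ge0 (\sum_i w i * x i); set sW := _ ^+ 2 => sW0 le.
have {}le : mu <= (1 + z%:R) * K + theta / 4 * (4 * K * (1 - K)) + m'%:R / (2 * theta).
  have : theta / 4 * (1 - tau ^+ 2 - (kappa ^+ 2 - tauW ^+ 2)) <= theta / 4 * (4 * K * (1 - K)).
    by rewrite ler_pM2l; lra.
  have : (1 + z%:R) * kappa <= (1 + z%:R) * K by rewrite ler_wpM2l // addr_ge0.
  by lra.
(* With [theta = mu / K] the excess over [mu] is a positive multiple of the claimed difference, so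
   [K] drops out. *)
have E : (1 + z%:R) * K + theta / 4 * (4 * K * (1 - K)) + m'%:R / (2 * theta) =
  mu + K / (2 * mu) * (2 * (1 + z%:R) * mu + m'%:R - 2 * mu ^+ 2).
  by rewrite /theta; field; rewrite !gt_eqF.
rewrite E lerDl pmulr_rge0 ?subr_ge0 // in le.
by apply: divr_gt0 => //; lra.
Qed.

End Rayleigh.

(** * Unit eigenvectors, sign of the least eigenvalue, and the chromatic number *)

Section LeastEigenvalue.
Variables (R : rcfType) (G : sgraph).

Lemma adjacency_eigenvalue (f : G -> R) (nu : R) (u : G) : f u != 0 ->
  (forall j, \sum_i f i * (adj i j)%:R = nu * f j) -> eigenvalue (adjacency R G) nu.
Proof.
move=> fu0 fE; apply/eigenvalueP; exists (\row_i f (enum_val i)).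
  apply/rowP=> j; rewrite !mxE -fE (reindex (@enum_rank G)) /=; last exact: onW_bij (@enum_rank_bij G).
  by apply: eq_bigr => i _; rewrite !mxE enum_rankK.
by apply: contraNneq fu0 => /rowP/(_ (enum_rank u)); rewrite !mxE enum_rankK => ->.
Qed.

Lemma unit_eigenvector (lambda : R) : eigenvalue (adjacency R G) lambda ->
  exists2 x : G -> R, \sum_i x i ^+ 2 = 1 &
    \sum_i \sum_j (adj i j)%:R * (x i * x j) = lambda.
Proof.
case/eigenvalueP=> v vE v0; pose y i := v 0 (enum_rank i).
pose S := \sum_i y i ^+ 2.
have S0 : 0 < S.
  rewrite lt_def sumr_ge0 ?andbT; last by move=> i _; apply: sqr_ge0.
  apply: contraNneq v0 => /psumr_eq0P yz; apply/eqP/rowP=> i.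
  have := yz (fun i _ => sqr_ge0 (y i)) (enum_val i) isT.
  by rewrite /y enum_valK mxE => /eqP; rewrite sqrf_eq0 => /eqP.
have yE j : \sum_i y i * (adj i j)%:R = lambda * y j.
  have := congr1 (fun w : 'rV_ _ => w 0 (enum_rank j)) vE; rewrite !mxE => <-.
  rewrite (reindex (@enum_rank G)) /=; last exact: onW_bij (@enum_rank_bij G).
  by apply: eq_bigr => i _; rewrite mxE !enum_rankK.
exists (fun i => y i / Num.sqrt S).
  under eq_bigr => i _ do rewrite expr_div_n sqr_sqrtr ?ltW //.
  by rewrite -mulr_suml divff // gt_eqF.
have -> : \sum_i \sum_j (adj i j)%:R * (y i / Num.sqrt S * (y j / Num.sqrt S)) =
    \sum_j (y j / S) * \sum_i y i * (adj i j)%:R.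
  rewrite exchange_big; apply: eq_bigr => j _; rewrite mulr_sumr; apply: eq_bigr => i _.
  rewrite -[S in RHS]sqr_sqrtr ?ltW // expr2; field.
  by rewrite sqrtr_eq0 -ltNge.
under eq_bigr => j _ do rewrite yE.
have -> : \sum_j y j / S * (lambda * y j) = \sum_j (lambda / S) * y j ^+ 2.
  by apply: eq_bigr => j _; ring.
by rewrite -mulr_sumr -/S divfK // gt_eqF.
Qed.

Lemma least_eigenvalue_lt0 (lambda : R) : (0 < gsize G)%N ->
  is_least_eigenvalue (adjacency R G) lambda -> lambda < 0.
Proof.
move=> m0 [_ least].
have [||| mu mu0 /least] := @symmetric_neg_eigenvalue R _ (adjacency R G).
- by apply/matrixP=> i j; rewrite !mxE adj_sym.
- by apply: big1 => i _; rewrite mxE adj_irrefl.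
- have /card_gt0P[e] := m0; case/imsetP=> -[x y]; rewrite inE /= => xy _.
  apply/eqP=> /matrixP/(_ (enum_rank x) (enum_rank y)).
  by rewrite !mxE !enum_rankK xy => /eqP; rewrite oner_eq0.
- by move=> le; apply: le_lt_trans mu0.
Qed.

Lemma chromatic_not_colors k : (k < chromatic_number G)%N -> ~ colors_in [set: G] k.
Proof.
rewrite /chromatic_number; case: ex_minnP => chi _ minchi kchi [c [ck cp]].
suff /minchi : colorable G k by rewrite leqNgt kchi.
apply/existsP; exists [ffun x => Ordinal (ck x (in_setT x))].
apply/forallP=> x; apply/forallP=> y; apply/implyP=> xy.
by rewrite !ffunE -val_eqE /= cp ?in_setT.
Qed.

Lemma chromatic_gt1 : (0 < gsize G)%N -> (1 < chromatic_number G)%N.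
Proof.
case/card_gt0P=> e /imsetP[[x y]]; rewrite inE /= => xy _.
rewrite /chromatic_number; case: ex_minnP => chi /existsP[c /forallP/(_ x)/forallP/(_ y)].
rewrite xy /= => + _; case: chi c => [|[|chi]] c //; first by case: (c x).
by rewrite !ord1 eqxx.
Qed.

End LeastEigenvalue.

(** * Extremal graphs *)

Section Isomorphism.
Variable G : sgraph.

(** Lets the isomorphisms below be written from the model graph, whose vertices are sums of
    ordinals. *)
Lemma giso_of_inverse (H : sgraph) (h : H -> G) : bijective h ->
  (forall u v, adj (h u) (h v) = adj u v) -> giso G H.
Proof.
case=> f hK fK hadj; exists f; first by exists h.
by move=> x y; rewrite -hadj !fK.
Qed.

Definition spanned_by_clique (W : {set G}) :=
  clique W /\ forall x y, adj x y -> (x \in W) && (y \in W).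

Definition spanned_by_biclique (P N : {set G}) := [disjoint P & N] /\
  forall x y, adj x y = (x \in P) && (y \in N) || (x \in N) && (y \in P).

Lemma giso_complete (W : {set G}) : spanned_by_clique W ->
  giso G (disjoint_union (complete_graph #|W|) (empty_graph (#|G| - #|W|))).
Proof.
case=> clW inW; have cC : #|~: W| = (#|G| - #|W|)%N by rewrite -(cardsC W) addKn.
pose h (u : 'I_#|W| + 'I_(#|G| - #|W|)) : G := match u with
  | inl i => enum_val i | inr j => enum_val (cast_ord (esym cC) j) end.
have hl i : h (inl i) \in W by apply: enum_valP.
have hr j : h (inr j) \notin W by have := enum_valP (cast_ord (esym cC) j); rewrite inE.
apply: (@giso_of_inverse (disjoint_union (complete_graph _) (empty_graph _)) h).
  apply: inj_card_bij; last by rewrite card_sum !card_ord subnKC ?max_card.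
  move=> [i|i] [j|j] E.
  - by move/enum_val_inj: E => ->.
  - by have := hr j; rewrite -E hl.
  - by have := hr i; rewrite E hl.
  - by move/enum_val_inj/cast_ord_inj: E => ->.
move=> [i|i] [j|j] /=; last 3 first.
- by apply/negP=> /inW; rewrite (negPf (hr j)) andbF.
- by apply/negP=> /inW; rewrite (negPf (hr i)).
- by apply/negP=> /inW; rewrite (negPf (hr i)).
rewrite /adj /= /complete_adj; case: eqVneq => [->|ij]; first exact: adj_irrefl.
by apply: clW; rewrite ?enum_valP // (inj_eq enum_val_inj).
Qed.

Lemma giso_completeP (k t : nat) :
  giso G (disjoint_union (complete_graph k) (empty_graph t)) ->
  exists2 W : {set G}, #|W| = k & spanned_by_clique W.
Proof.
case=> f [g fK gK] fadj; exists [set g (inl i) | i : 'I_k].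
  by rewrite card_imset ?card_ord // => i j /(can_inj gK) [].
split=> [x y|x y].
  move=> /imsetP[i _ ->] /imsetP[j _ ->]; rewrite -fadj !gK /= => gij.
  by rewrite /adj /= /complete_adj; apply: contraNneq gij => ->.
rewrite -fadj => fxy; have [i fx] : exists i, f x = inl i.
  by case: (f x) fxy => [i|i] //; [exists i|case: (f y)].
have [j fy] : exists j, f y = inl j.
  by case: (f y) fxy => [j|j] //; [exists j|rewrite fx].
by rewrite -[x]fK -[y]fK fx fy !imset_f.
Qed.

Lemma giso_bipartite (P N : {set G}) : spanned_by_biclique P N ->
  giso G (disjoint_union (complete_bipartite #|P| #|N|) (empty_graph (#|G| - #|P| - #|N|))).
Proof.
case=> disj adjE.
have cC : #|~: (P :|: N)| = (#|G| - #|P| - #|N|)%N.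
  by rewrite -(cardsC (P :|: N)) cardsU disjoint_setI0 // cards0; lia.
pose h (u : 'I_#|P| + 'I_#|N| + 'I_(#|G| - #|P| - #|N|)) : G := match u with
  | inl (inl i) => enum_val i | inl (inr i) => enum_val i
  | inr j => enum_val (cast_ord (esym cC) j) end.
have hP i : (h (inl (inl i)) \in P) * (h (inl (inl i)) \in N = false).
  by rewrite /h enum_valP (disjointFr disj) ?enum_valP.
have hN i : (h (inl (inr i)) \in N) * (h (inl (inr i)) \in P = false).
  by rewrite /h enum_valP (disjointFl disj) ?enum_valP.
have hr j : (h (inr j) \in P = false) * (h (inr j) \in N = false).
  by have := enum_valP (cast_ord (esym cC) j); rewrite !inE negb_or => /andP[/negPf-> /negPf->].
apply: (@giso_of_inverse (disjoint_union (complete_bipartite _ _) (empty_graph _)) h).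
  apply: inj_card_bij; last first.
    by rewrite !card_sum !card_ord -cC -(cardsC (P :|: N)) cardsU disjoint_setI0 // cards0; lia.
  move=> [[i|i]|i] [[j|j]|j] E; try by move/enum_val_inj: E => ->.
  - by have := hP i; rewrite E !hN => -[].
  - by have := hP i; rewrite E !hr => -[].
  - by have := hN i; rewrite E !hP => -[].
  - by have := hN i; rewrite E !hr => -[].
  - by have := hP j; rewrite -E !hr => -[].
  - by have := hN j; rewrite -E !hr => -[].
  - by move/enum_val_inj/cast_ord_inj: E => ->.
by move=> [[i|i]|i] [[j|j]|j]; rewrite adjE ?hP ?hN ?hr.
Qed.

Lemma giso_bipartiteP (a b t : nat) :
  giso G (disjoint_union (complete_bipartite a b) (empty_graph t)) ->
  exists P N : {set G}, [/\ #|P| = a, #|N| = b & spanned_by_biclique P N].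
Proof.
case=> f [g fK gK] fadj.
exists [set g (inl (inl i)) | i : 'I_a], [set g (inl (inr i)) | i : 'I_b].
have mP x : (x \in [set g (inl (inl i)) | i : 'I_a]) = (if f x is inl (inl _) then true else false).
  apply/imsetP/idP => [[i _ ->]|]; first by rewrite gK.
  by case E : (f x) => [[i|]|] // _; exists i; rewrite // -E fK.
have mN x : (x \in [set g (inl (inr i)) | i : 'I_b]) = (if f x is inl (inr _) then true else false).
  apply/imsetP/idP => [[i _ ->]|]; first by rewrite gK.
  by case E : (f x) => [[|i]|] // _; exists i; rewrite // -E fK.
split.
- by rewrite card_imset ?card_ord // => i j /(can_inj gK) [].
- by rewrite card_imset ?card_ord // => i j /(can_inj gK) [].
split.
  by apply/pred0P => x /=; rewrite mP mN; case: (f x) => [[]|].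
by move=> x y; rewrite -fadj !mP !mN; case: (f x) => [[]|] i; case: (f y) => [[]|] j.
Qed.

End Isomorphism.

(** * Numerical estimates *)

Section Estimates.
Variable R : realFieldType.
Implicit Types mu c y e z q s Z : R.

(** For [mu > 1], factor [s * (s - 1)] as [(mu^2 - mu) * (mu^2 + mu)]; the second factor is below
    [s + y - 1]. *)
Lemma estimate_small_mu mu y e : 0 < mu -> 0 < e -> mu < y - 1 ->
  mu ^+ 2 - mu <= e -> mu ^+ 2 * (mu ^+ 2 - 1) < e * (mu ^+ 2 + y - 1).
Proof.
move=> mu0 e0 muy mue.
have h : 0 < mu ^+ 2 + y - 1 by nra.
have [mu1|mu1] := lerP mu 1; first by have := mulr_gt0 e0 h; nra.
apply: (@lt_le_trans _ _ ((mu ^+ 2 - mu) * (mu ^+ 2 + y - 1))); last first.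
  by rewrite ler_pM2r.
have := mulr_gt0 (mulr_gt0 mu0 (_ : 0 < mu - 1)) (_ : 0 < y - 1 - mu).
nra.
Qed.

(** Insert [e > s - q]: the cut bound suffices once [s] is large. *)
Lemma estimate_cut s y e q : 0 < s -> 1 <= y -> s < e + q ->
  q * (y - 1) <= s * (y - q) -> s * (s - 1) < e * (s + y - 1).
Proof.
move=> s0 y1 seq h.
have h2 : (s - q) * (s + y - 1) < e * (s + y - 1) by rewrite ltr_pM2r; lra.
nra.
Qed.

(** The same cut bound suffices once [e] is large. *)
Lemma estimate_cut_e s y e q : 0 < s -> 1 <= q -> s < e + q ->
  q * (q - 1) <= e * (y - q) -> s * (s - 1) < e * (s + y - 1).
Proof.
move=> s0 q1 seq h.
have : 0 < (e + q - s) * (q + s - 1) by apply: mulr_gt0; lra.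
nra.
Qed.

(** As [mu > c], the right side increases with [z], and [z] can be replaced by its maximum
    [e / c]. *)
Lemma estimate_linear mu c e z : 0 < c -> c < mu -> z * c <= e ->
  mu ^+ 2 <= (1 + z) * mu + e - z * c -> c * (mu - 1) <= e.
Proof.
move=> c0 cmu zce h.
have h1 : c * mu ^+ 2 <= c * ((1 + z) * mu + e - z * c) by rewrite ler_pM2l.
have h2 : (z * c) * (mu - c) <= e * (mu - c) by rewrite ler_pM2r; lra.
have h3 : c * (mu - 1) * mu <= e * mu by nra.
by rewrite -(ler_pM2r (_ : 0 < mu)); lra.
Qed.

(** Here [c = (chi - 1) / 2], so [9/2 <= c] means [chi >= 10]. The cut bound handles large [mu], and
    [estimate_linear] the rest. *)
Lemma estimate_large mu c y e z q : 9/2 <= c -> c < mu ->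
  y = c * (2 * c + 1) -> z * c <= e -> 4 * q <= 4 * y - (4 * c ^+ 2 + 3) ->
  mu ^+ 2 < e + q -> mu ^+ 2 <= (1 + z) * mu + e - z * c ->
  mu ^+ 2 * (mu ^+ 2 - 1) < e * (mu ^+ 2 + y - 1).
Proof.
move=> c92 cmu ye zce hq hs hmu.
(* This threshold is a polynomial upper bound for [q * (y - 1) / (y - q)] at the largest admissible
   [q], with the two leading terms agreeing after clearing the denominator. *)
have [big|small] := lerP (2 * c ^+ 2 + 3 * c - 3) (mu ^+ 2).
  apply: (@estimate_cut _ _ _ (y - c ^+ 2 - 3/4)); [nra|nra|nra|].
  have -> : y - (y - c ^+ 2 - 3/4) = c ^+ 2 + 3/4 by ring.
  apply: (@le_trans _ _ ((2 * c ^+ 2 + 3 * c - 3) * (c ^+ 2 + 3/4))); first by rewrite ye; nra.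
  by rewrite ler_pM2r; nra.
have le := estimate_linear (_ : 0 < c) cmu zce hmu.
have {}le : c * (mu - 1) <= e by apply: le; lra.
have y0 : 0 < mu ^+ 2 + y - 1 by rewrite ye; nra.
apply: (@lt_le_trans _ _ (c * (mu - 1) * (mu ^+ 2 + y - 1))); last by rewrite ler_pM2r.
suff : 0 < (mu - 1) * (c * (mu ^+ 2 + y - 1) - mu ^+ 2 * (mu + 1)) by nra.
apply: mulr_gt0; first lra.
rewrite subr_gt0.
(* [2 sqrt u <= t + u / t] with [u = 2 c^2 + 3 c - 3] and [t = (3 c + 1) / 2] *)
have mu_le : mu * (3 * c + 1) <= 17/4 * c ^+ 2 + 9/2 * c - 11/4.
  have := sqr_ge0 (2 * mu - (3 * c + 1)); nra.
have h1 : (mu + 1 - c) * (3 * c + 1) <= 5/4 * c ^+ 2 + 13/2 * c - 7/4 by nra.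
have h2 : mu ^+ 2 * ((mu + 1 - c) * (3 * c + 1)) <=
    (2 * c ^+ 2 + 3 * c - 3) * (5/4 * c ^+ 2 + 13/2 * c - 7/4).
  apply: ler_pM; [nra| |lra|lra].
  by apply: mulr_ge0; lra.
have h3 : (2 * c ^+ 2 + 3 * c - 3) * (5/4 * c ^+ 2 + 13/2 * c - 7/4) <
    (3 * c + 1) * (c * (2 * c ^+ 2 + c - 1)).
  have [d d0 ->] : exists2 d, 0 <= d & c = d + 9/2 by exists (c - 9/2); lra.
  have := mulr_ge0 d0 d0; have := mulr_ge0 d0 (mulr_ge0 d0 d0).
  have := sqr_ge0 (d ^+ 2).
  nra.
rewrite -subr_gt0 -(pmulr_lgt0 _ (_ : 0 < 3 * c + 1)); last lra.
rewrite ye; nra.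
Qed.

(** The lower bound on [e] decreases with [z] for [mu > c], so [z = Z] leaves a polynomial
    inequality in [mu] alone. *)
Lemma estimate_special mu c y e z Z : 0 < mu -> 0 < e -> c < mu -> 0 < mu ^+ 2 + y - 1 ->
  z <= Z -> mu ^+ 2 <= (1 + z) * mu + e - z * c ->
  0 < (mu ^+ 2 - (1 + Z) * mu + Z * c) * (mu ^+ 2 + y - 1) - mu ^+ 2 * (mu ^+ 2 - 1) ->
  mu ^+ 2 * (mu ^+ 2 - 1) < e * (mu ^+ 2 + y - 1).
Proof.
move=> mu0 e0 cmu y0 zZ h.
rewrite subr_gt0 => /lt_le_trans; apply.
rewrite ler_pM2r //.
suff : z * (mu - c) <= Z * (mu - c) by nra.
by rewrite ler_pM2r; lra.
Qed.

(** Three ranges: [mu <= c], then [e >= e0] by the cut bound, then finitely many [e], for which [mu]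
    and [z] are bounded. *)
Lemma estimate_finite mu c y q0 Z (e z q e0 : nat) : 0 < mu -> 1 < c ->
  y = c * (2 * c + 1) -> 1 <= q0 -> (0 < z)%N ->
  z%:R * c <= e%:R -> q%:R <= q0 -> mu ^+ 2 < e%:R + q%:R ->
  mu ^+ 2 <= (1 + z%:R) * mu + e%:R - z%:R * c ->
  q0 * (q0 - 1) <= e0%:R * (y - q0) ->
  ((e < e0)%N -> z%:R <= Z) ->
  (forall t : R, c < t -> t ^+ 2 < e0%:R - 1 + q0 ->
   0 < (t ^+ 2 - (1 + Z) * t + Z * c) * (t ^+ 2 + y - 1) - t ^+ 2 * (t ^+ 2 - 1)) ->
  q0 <= y ->
  mu ^+ 2 * (mu ^+ 2 - 1) < e%:R * (mu ^+ 2 + y - 1).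
Proof.
move=> mu0 c1 ye q01 z1 zce qq0 hs hmu he0 hZ poly q0y.
have z1R : (1 : R) <= z%:R by rewrite (ler_nat R 1).
have e_gt0 : (0 : R) < e%:R by nra.
have [muc|cmu] := lerP mu c.
  by apply: estimate_small_mu => //; rewrite ?ye; nra.
have [ee0|] := ltnP e e0; last first.
  rewrite -(ler_nat R) => e0e.
  apply: (@estimate_cut_e _ _ _ q0) => //; [nra|lra|].
  apply: (le_trans he0); rewrite ler_wpM2r //; lra.
have eR : e%:R <= e0%:R - 1 :> R.
  by rewrite lerBrDr natr1 ler_nat.
apply: (@estimate_special _ c _ _ z%:R Z) => //; first by rewrite ye; nra.
  exact: hZ.
by apply: poly => //; lra.
Qed.

(* Here [q] is [y] minus the number of edges not across the sign partition. *)
Lemma estimate_clique_free mu (chi y e z q : nat) : (4 <= chi)%N -> 0 < mu ->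
  (2 * y = chi * (chi - 1))%N -> (0 < z)%N -> (z * (chi - 1) <= 2 * e)%N ->
  (4 * q + chi * (chi - 2) + 4 <= 4 * y)%N -> mu ^+ 2 < e%:R + q%:R ->
  2 * mu ^+ 2 <= 2 * (1 + z%:R) * mu + 2 * e%:R - z%:R * (chi%:R - 1) ->
  mu ^+ 2 * (mu ^+ 2 - 1) < e%:R * (mu ^+ 2 + y%:R - 1).
Proof.
move=> chi4 mu0 hy z1 hz hq hs hmu.
have chiR : (4 : R) <= chi%:R by rewrite (ler_nat R 4).
have yR : 2 * y%:R = chi%:R * (chi%:R - 1) :> R.
  by rewrite -(natrM R 2) hy natrM natrB //; lia.
have zR : z%:R * (chi%:R - 1) <= 2 * e%:R :> R.
  by rewrite -[1]/(1%:R) -natrB -?natrM ?ler_nat //; lia.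
have z1R : (1 : R) <= z%:R by rewrite (ler_nat R 1).
pose c : R := (chi%:R - 1) / 2.
have [chi10|chi9] := leqP 10 chi.
  have chi10R : (10 : R) <= chi%:R by rewrite (ler_nat R 10).
  have e_gt0 : (0 : R) < e%:R by nra.
  have yc : y%:R = c * (2 * c + 1) by rewrite /c; nra.
  have [muc|cmu] := lerP mu c.
    by apply: estimate_small_mu => //; [rewrite yc /c in muc *; nra|rewrite /c in muc; nra].
  apply: (@estimate_large _ c _ _ z%:R q%:R) => //; try by rewrite /c; lra.
  have : (4 * q + chi * (chi - 2) + 4)%:R <= (4 * y)%:R :> R by rewrite ler_nat.
  by rewrite !natrD !natrM natrB ?/c; [lra|lia].
(* [q0] is the largest possible [q]; the cut estimate settles [e >= e0], and
   smaller [e] force [z <= Z] and [mu < T]. *)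
have small (k e0 q0 Z : nat) (T : R) : chi = k ->
    (q <= q0)%N -> (0 < q0 <= y)%N -> (q0 * (q0 - 1) + e0 * q0 <= e0 * y)%N ->
    ((e < e0)%N -> (z <= Z)%N) ->
    e0%:R - 1 + q0%:R <= T ^+ 2 -> 0 < T ->
    (forall t : R, (k%:R - 1) / 2 < t -> t < T -> 0 < (t - (k%:R - 1) / 2) * (T - t) ->
      0 < (t ^+ 2 - (1 + Z%:R) * t + Z%:R * ((k%:R - 1) / 2)) * (t ^+ 2 + k%:R * (k%:R - 1) / 2 - 1)
          - t ^+ 2 * (t ^+ 2 - 1)) ->
    mu ^+ 2 * (mu ^+ 2 - 1) < e%:R * (mu ^+ 2 + y%:R - 1).
  move=> chik qq0 /andP[q0_gt0 q0y] hq0 hZ; rewrite -chik => hT T0 poly.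
  apply: (@estimate_finite _ c _ q0%:R Z%:R e z q e0) => //.
  - by rewrite /c; lra.
  - by rewrite /c; lra.
  - by rewrite (ler_nat R 1).
  - by rewrite /c; lra.
  - by rewrite ler_nat.
  - by rewrite /c; lra.
  - have : (q0 * (q0 - 1) + e0 * q0)%:R <= (e0 * y)%:R :> R by rewrite ler_nat.
    by rewrite natrD !natrM natrB //; lra.
  - by move=> /hZ; rewrite ler_nat.
  - have -> : y%:R = chi%:R * (chi%:R - 1) / 2 :> R by lra.
    move=> t t1 t2; have t0 : 0 < t by rewrite /c in t1; lra.
    have t3 : t < T by rewrite -ltr_sqr ?nnegrE ?(ltW t0) ?(ltW T0) // (lt_le_trans t2).
    by apply: poly => //; apply: mulr_gt0; rewrite subr_gt0.
  - by rewrite ler_nat.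
have [X|[X|[X|[X|[X|X]]]]] : chi = 4%N \/ chi = 5%N \/ chi = 6%N \/ chi = 7%N \/
    chi = 8%N \/ chi = 9%N by lia.
all: clear yR zR z1R chiR hs hmu mu0 chi9 chi4; subst chi.
(* In each case [e0] is least with [q0 * (q0 - 1) <= e0 * (y - q0)], [Z] is the largest [z] with
   [z * (chi - 1) <= 2 * (e0 - 1)], and [T] is a rational equal to or just above the root of
   [e0 - 1 + q0]. *)
- apply: (small 4%N 2%N 3%N 0%N 2) => //; try lia; clear; first by lra.
  by move=> t t1 t2 _; have := mulr_gt0 (_ : 0 < t * (t - 1)) (_ : 0 < 5 - t); nra.
- by apply: (small 5%N 4%N 5%N 1%N (17/6)) => //; try lia; clear; [lra|lra|move=> t; nra].
- by apply: (small 6%N 8%N 8%N 2%N (31/8)) => //; try lia; clear; [lra|lra|move=> t; nra].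
- by apply: (small 7%N 11%N 11%N 3%N (23/5)) => //; try lia; clear; [lra|lra|move=> t; nra].
- by apply: (small 8%N 17%N 15%N 4%N (28/5)) => //; try lia; clear; [lra|lra|move=> t; nra].
- by apply: (small 9%N 21%N 19%N 5%N (25/4)) => //; try lia; clear; [lra|lra|move=> t; nra].
Qed.
End Estimates.

(** * The strict inequality *)

Section Core.
Variables (R : rcfType) (G : sgraph) (k : nat).
Variables (x : G -> R) (mu : R).
Hypothesis nk : ~ colors_in [set: G] k.
Hypothesis mu_gt0 : 0 < mu.
Hypothesis norm1 : \sum_i x i ^+ 2 = 1.
Hypothesis energy : \sum_i \sum_j (adj i j)%:R * (x i * x j) = - mu.

Let neg_arcs := arcs (fun i j => x i * x j < 0).

Lemma eigenvalue_le_size : mu ^+ 2 <= (gsize G)%:R.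
Proof.
have := eigenvalue_le_neg_arcs mu_gt0 norm1 energy.
have : (arcs (fun i j => x i * x j < 0))%:R <= (2 * gsize G)%:R :> R.
  by rewrite ler_nat -arcs_gsize; apply: arcs_sub.
by rewrite natrM; lra.
Qed.

(** All arcs must join opposite signs, and tightness of the cut bound makes every pair of opposite
    signs adjacent. *)
Lemma eigenvalue_eq_size : (gsize G)%:R <= mu ^+ 2 ->
  spanned_by_biclique [set i | 0 < x i] [set i | x i < 0].
Proof.
move=> le; have neg_eq : (2 * gsize G <= neg_arcs)%N.
  rewrite -(ler_nat R) natrM.
  by have := eigenvalue_le_neg_arcs mu_gt0 norm1 energy; rewrite -/neg_arcs; lra.
have neg_le : (neg_arcs <= 2 * gsize G)%N by rewrite -arcs_gsize; apply: arcs_sub.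
have tight : neg_arcs%:R <= 2 * mu ^+ 2 by move: neg_le; rewrite -(ler_nat R) natrM; lra.
split.
  apply/pred0P=> i /=; rewrite !inE; apply/negP=> /andP[/lt_trans h /h].
  by rewrite ltxx.
move=> i j; rewrite !inE; have [_ to_adj] := eigenvalue_eq_neg_arcs mu_gt0 norm1 energy i j tight.
apply/idP/idP => [ij|/orP[]/andP[xi xj]]; last 2 first.
- by apply: to_adj; rewrite pmulr_rlt0.
- by apply: to_adj; rewrite nmulr_rlt0.
have : x i * x j < 0.
  apply: contraLR neg_eq => xij; rewrite -ltnNge -arcs_gsize.
  apply: (@leq_trans (neg_arcs + arcs (fun a b => ~~ (x a * x b < 0)))).
    by rewrite -addn1 leq_add2l; apply: ltnW; apply: (arcs_pair ij); rewrite // mulrC.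
  by apply: arcsU => a b _ // ->.
case: (ltrgtP (x i) 0) => xi; rewrite ?xi ?mul0r ?ltxx //.
  by rewrite nmulr_rlt0.
by rewrite pmulr_rlt0 // orbF.
Qed.

(** Strictness is the point. Either the cut bound is strict, and [A] is the set of nonnegative
    vertices; or it is tight, and [separating_arcs] yields two arcs more than [k * (k - 1)]. *)
Lemma eigenvalue_cut : (1 < k)%N -> exists b,
  2 * mu ^+ 2 + (2 * b)%:R < (2 * gsize G)%:R /\
  (2 * b = k * k.-1 \/ exists A : {set G}, 2 * b = arcs_in A + arcs_in (~: A))%N.
Proof.
move=> k2; pose A := [set i | 0 <= x i].
have := eigenvalue_le_neg_arcs mu_gt0 norm1 energy; rewrite le_eqVlt -/neg_arcs.
case/orP=> [/eqP tight|lt].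
  pose P := [set i | 0 < x i]; pose N := [set i | x i < 0].
  have tight' : neg_arcs%:R <= 2 * mu ^+ 2 by rewrite tight.
  have nonneg i j := proj1 (eigenvalue_eq_neg_arcs mu_gt0 norm1 energy i j tight').
  have disj : [disjoint P & N].
    by apply/pred0P=> i /=; rewrite !inE; apply/negP=> /andP[/lt_trans h /h]; rewrite ltxx.
  have indP : {in P &, forall i j, ~~ adj i j}.
    move=> i j; rewrite !inE => xi xj; apply/negP=> /nonneg.
    by rewrite leNgt mulr_gt0.
  have indN : {in N &, forall i j, ~~ adj i j}.
    move=> i j; rewrite !inE => xi xj; apply/negP=> /nonneg.
    by rewrite leNgt nmulr_rgt0 ?xj.
  have sep := separating_arcs k2 nk disj indP indN.
  have : (neg_arcs + (k * k.-1 + 2) <= 2 * gsize G)%N.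
    apply: leq_trans (leq_add (leqnn _) sep) _; rewrite -arcs_gsize; apply: arcsU => // i j _.
    rewrite !inE => xij; apply/negP; rewrite !negb_or -!leNgt => /orP[]/andP[h1 h2].
      have xi : x i = 0 by apply/eqP; rewrite eq_le h1.
      by rewrite xi mul0r ltxx in xij.
    have xj : x j = 0 by apply/eqP; rewrite eq_le h1.
    by rewrite xj mulr0 ltxx in xij.
  have [b kb] : exists b, (k * k.-1 = 2 * b)%N.
    by exists 'C(k, 2); have := bin_ffact k 2; rewrite ffactnS ffactn1 (_ : 2`! = 2)%N //; lia.
  move=> le; exists b; split; last by left.
  by rewrite tight -natrD ltr_nat -kb; lia.
have [a Ea] := arcs_in_even A; have [b Eb] := arcs_in_even (~: A).
exists (a + b)%N; split; last by right; exists A; lia.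
apply: (@lt_le_trans _ _ (neg_arcs%:R + (2 * (a + b))%:R)); first by rewrite ltrD2r.
rewrite -natrD ler_nat -arcs_gsize mulnDr -Ea -Eb.
apply: (@leq_trans (neg_arcs + arcs (fun i j => (i \in A) == (j \in A)))).
  rewrite leq_add2l; apply: arcsU => i j _; rewrite !inE; first by case/andP=> ->.
  by case/orP=> /andP[]; rewrite ?inE; [move=> -> ->|move=> /negPf-> /negPf->].
apply: arcsU => // i j _ xij; rewrite !inE.
case: (lerP 0 (x i)) => xi; case: (lerP 0 (x j)) => xj //.
  by move: xij; rewrite ltNge mulr_ge0.
by move: xij; rewrite ltNge mulr_le0 ?ltW.
Qed.

(** A vertex of [W] has at most [z] non-neighbours in [W], and at most
    [2 * gsize G - (k + 1 + z) * k] arcs are not inside [W]. *)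
Lemma eigenvalue_le_mindeg (W : {set G}) z : #|W| = (k.+1 + z)%N ->
  {in W, forall i, k <= deg_in W i}%N ->
  2 * mu ^+ 2 <= 2 * (1 + z%:R) * mu + (2 * gsize G)%:R - ((k.+1 + z) * k)%:R /\
  ((k.+1 + z) * k <= 2 * gsize G)%N.
Proof.
move=> cW degW; have arcsW : ((k.+1 + z) * k <= arcs_in W)%N.
  by rewrite arcs_inE -cW -sum_nat_const; apply: leq_sum.
pose m' := arcs (fun i j : G => ~~ ((i \in W) && (j \in W))).
have mm : (arcs_in W + m' <= 2 * gsize G)%N.
  by rewrite -arcs_gsize; apply: arcsU => i j _ // ->.
split; last by lia.
have nonadj : {in W, forall i, #|[set j in W | (j != i) && ~~ adj i j]| <= z}%N.
  move=> i iW.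
  have : (#|[set j in W | (j != i) && ~~ adj i j]| + deg_in W i <= #|W :\ i|)%N.
    rewrite /deg_in -leq_subRL; last first.
      by apply/subset_leq_card/subsetP=> j; rewrite !inE => /and3P[-> -> _].
    have sub : [set j in W | (j != i) && ~~ adj i j] \subset W :\ i.
      by apply/subsetP=> j; rewrite !inE => /and3P[-> -> _].
    rewrite -{1}(setIidPr sub) -cardsD; apply/subset_leq_card/subsetP=> j.
    rewrite !inE => /andP[-> ij]; rewrite ij !andbF /= andbT.
    by apply: contraTneq ij => ->; rewrite adj_irrefl.
  by have := degW i iW; have := cardsD1 i W; rewrite iW cW; lia.
apply: le_trans (eigenvalue_le_dense mu_gt0 norm1 energy nonadj) _; rewrite -/m'.
rewrite -addrA lerD2l lerBrDr -natrD ler_nat.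
by lia.
Qed.

(** With [chi = k + 1], the cases are: a [chi]-clique, where [mu^2 - mu <= e]; no triangle and
    [chi = 3]; no clique and [chi >= 4]. *)
Lemma strict_bound (y : nat) : (2 * y = k.+1 * k)%N -> (1 < k)%N -> (y < gsize G)%N ->
  mu ^+ 2 * (mu ^+ 2 - 1) < ((gsize G)%:R - y%:R) * (mu ^+ 2 + y%:R - 1).
Proof.
have mu0 := mu_gt0.
move=> y2 k2 ym; set m := gsize G in ym *.
have [e e0 me] : exists2 e, (0 < e)%N & m = (y + e)%N by exists (m - y)%N; lia.
have -> : m%:R - y%:R = e%:R :> R by rewrite me natrD addrAC subrr add0r.
have e1 : 1 <= e%:R :> R by rewrite (ler_nat R 1).
have y3 : 3 <= y%:R :> R by rewrite (ler_nat R 3); nia.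
have s0 : 0 < mu ^+ 2 by rewrite exprn_gt0.
have [b [cutb bE]] := eigenvalue_cut k2.
have b4 : (k.+1 * k.-1 <= 4 * b)%N.
  case: bE => [bE|[A bA]]; last by have := arcs_in_setC A nk; lia.
  by rewrite (_ : 4 * b = 2 * (2 * b))%N ?bE ?mulnA ?leq_mul2r; lia.
have cut : mu ^+ 2 < e%:R + y%:R - b%:R.
  by move: cutb; rewrite -/m me !natrM natrD; lra.
have [/existsP[W /andP[/eqP cW /forall_inP degW]]|noclique] :=
    boolP [exists W : {set G}, (#|W| == k.+1) && [forall i in W, k <= deg_in W i]%N].
  have [|le _] := @eigenvalue_le_mindeg W 0 _ degW; first by rewrite addn0.
  have le1 : mu ^+ 2 - mu <= e%:R.
    by move: le; rewrite addn0 -y2 -/m me !natrM natrD; lra.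
  have [small|big] := ltrP mu (y%:R - 1); first by apply: estimate_small_mu; lra.
  apply: (@estimate_cut _ _ _ _ (y%:R - b%:R)) => //; [lra|lra|].
  have b1 : 1 <= b%:R :> R by rewrite (ler_nat R 1); nia.
  have : (y%:R - 1) ^+ 2 * b%:R <= mu ^+ 2 * b%:R by rewrite ler_pM2r; nra.
  have : 0 <= (y%:R - 1) * y%:R * (b%:R - 1) :> R by rewrite !mulr_ge0 //; lra.
  by nra.
have free (W : {set G}) : #|W| = k.+1 -> ~ clique W.
  move=> cW clW; move/negP: noclique; apply; apply/existsP; exists W.
  rewrite cW eqxx /=; apply/forall_inP=> i iW; rewrite -ltnS -cW.
  rewrite (cardsD1 i) iW add1n ltnS; apply/subset_leq_card/subsetP=> j.
  by rewrite !inE => /andP[ji jW]; rewrite jW clW // eq_sym.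
have [k3|k3] := ltnP 2 k; last first.
  have {}k2 : k = 2%N by lia.
  have e2 : (2 <= e)%N.
    have := @gsize_triangle_free G; rewrite -k2 -/m me => /(_ nk); rewrite k2 in free *.
    by move=> /(_ free); lia.
  have {}e2 : 2 <= e%:R :> R by rewrite (ler_nat R 2).
  have yE : y%:R = 3 :> R by congr (_%:R); lia.
  have b1 : 1 <= b%:R :> R by rewrite (ler_nat R 1); nia.
  by apply: (@estimate_cut_e _ _ _ _ 2); rewrite ?yE; lra.
have b4' : (k.+1 * k.-1 + 4 <= 4 * b)%N.
  case: bE => [bE|[A bA]]; last by have := arcs_in_setC_clique_free A k3 nk free; lia.
  by rewrite (_ : 4 * b = 2 * (2 * b))%N ?bE; nia.
have [/denseP[W [_ /set0Pn[w wW] degW]]|//] := dense_or_colors [set: G] k.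
have Wk : (k < #|W|)%N := leq_ltn_trans (degW w wW) (deg_in_lt wW).
have Wk1 : #|W| != k.+1.
  by apply/eqP=> cW; apply: (free W cW); apply: clique_of_deg cW degW.
have [z z0 cW] : exists2 z, (0 < z)%N & #|W| = (k.+1 + z)%N.
  by exists (#|W| - k.+1)%N; lia.
have [le le2] := eigenvalue_le_mindeg cW degW.
apply: (@estimate_clique_free _ _ k.+1 y e z (y - b)) => //.
- by rewrite subn1.
- by rewrite subn1 /=; move: le2; rewrite -/m me; lia.
- by have : (k.+1 * k.-1 + 4 <= 4 * y)%N; [nia|rewrite (_ : k.+1 - 2 = k.-1)%N; lia].
- have : y%:R - b%:R <= (y - b)%:R :> R by rewrite lerBlDr -natrD ler_nat; lia.
  by lra.
- move: le; rewrite -/m me mulnDl -y2 -natr1 !(natrM, natrD); lra.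
Qed.

End Core.

(** * Equality and the theorem *)

Section Extremal.
Variables (R : rcfType) (G : sgraph).

(** The eigenvector is the difference of the indicators of two clique vertices. *)
Lemma clique_eigenvalue (W : {set G}) : spanned_by_clique W -> (1 < #|W|)%N ->
  eigenvalue (adjacency R G) (-1).
Proof.
case=> clW inW /card_gt1P[u [v [uW vW uv]]].
pose f i : R := (i == u)%:R - (i == v)%:R.
apply: (@adjacency_eigenvalue _ _ f _ u) => [|j].
  by rewrite /f eqxx (negPf uv) subr0 oner_eq0.
have -> : \sum_i f i * (adj i j)%:R = (adj u j)%:R - (adj v j)%:R.
  rewrite (bigD1 u) //= (bigD1 v) 1?eq_sym //= big1 => [|i /andP[/negPf iu /negPf iv]].
    by rewrite /f !eqxx [v == u]eq_sym (negPf uv) /=; ring.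
  by rewrite /f iu iv subrr mul0r.
rewrite mulN1r /f; have [ju|ju] := eqVneq j u.
  by rewrite ju (negPf uv) adj_irrefl clW //= 1?eq_sym //; ring.
have [jv|jv] := eqVneq j v; first by rewrite jv adj_irrefl clW //=; ring.
rewrite subrr oppr0; have [jW|jW] := boolP (j \in W).
  by rewrite !clW // 1?eq_sym // subrr.
have nadj i : adj i j = false by apply/negP=> /inW; rewrite (negPf jW) andbF.
by rewrite !nadj subrr.
Qed.

(** The eigenvector is the root of [#|N|] on [P] and minus the root of [#|P|] on [N]. *)
Lemma biclique_eigenvalue (P N : {set G}) : spanned_by_biclique P N ->
  (0 < #|P|)%N -> (0 < #|N|)%N ->
  eigenvalue (adjacency R G) (- Num.sqrt (#|P| * #|N|)%:R).
Proof.
case=> disj adjE P0 N0; case/card_gt0P: (P0) => u uP.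
pose a : R := Num.sqrt #|P|%:R; pose b : R := Num.sqrt #|N|%:R.
have a2 : a * a = #|P|%:R by rewrite -expr2 sqr_sqrtr ?ler0n.
have b2 : b * b = #|N|%:R by rewrite -expr2 sqr_sqrtr ?ler0n.
have -> : Num.sqrt (#|P| * #|N|)%:R = a * b :> R by rewrite natrM sqrtrM ?ler0n.
pose f i : R := (i \in P)%:R * b - (i \in N)%:R * a.
apply: (@adjacency_eigenvalue _ _ f _ u) => [|j].
  rewrite /f uP (disjointFr disj uP) mul1r mul0r subr0 sqrtr_eq0 -ltNge.
  by rewrite ltr0n.
have sumI (Q : {set G}) : \sum_i ((i \in Q)%:R : R) = #|Q|%:R.
  by rewrite -sum1_card natr_sum [RHS]big_mkcond; apply: eq_bigr => i _; case: (i \in Q).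
have -> : \sum_i f i * (adj i j)%:R =
    (j \in N)%:R * b * \sum_i ((i \in P)%:R : R) - (j \in P)%:R * a * \sum_i ((i \in N)%:R : R).
  rewrite !mulr_sumr -sumrB; apply: eq_bigr => i _; rewrite adjE /f.
  have [iP|iP] := boolP (i \in P); first by rewrite (disjointFr disj iP) orbF /=; ring.
  by case: (i \in N); case: (j \in P) => /=; ring.
by rewrite !sumI -a2 -b2 /f; ring.
Qed.

Lemma gsize_clique (W : {set G}) : spanned_by_clique W ->
  (2 * gsize G <= #|W| * #|W|.-1)%N.
Proof.
case=> _ inW; rewrite -arcs_gsize; apply: (@leq_trans (arcs_in W)).
  by apply: arcs_sub => i j /inW.
rewrite arcs_inE -sum_nat_const; apply: leq_sum => i iW.
by rewrite -ltnS prednK ?deg_in_lt //; apply/card_gt0P; exists i.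
Qed.

Lemma gsize_biclique (P N : {set G}) : spanned_by_biclique P N ->
  (gsize G <= #|P| * #|N|)%N.
Proof.
case=> _ adjE; rewrite -(leq_pmul2l (isT : 0 < 2)%N) -arcs_gsize mul2n -addnn.
rewrite {2}[(_ * _)%N]mulnC -!cardsX; apply: leq_trans (leq_card_setU _ _).
apply/subset_leq_card/subsetP => -[i j]; rewrite !inE /= andbT adjE.
by case/orP=> ->; rewrite ?orbT.
Qed.

End Extremal.

(** * From the polynomial inequality to the square root, and the theorem *)

Lemma quadratic_root_bound (R : rcfType) (s m y : R) :
  s * (s - 1) <= (m - y) * (s + y - 1) ->
  2 * y <= m + 1 - s + Num.sqrt ((m + 1 - s) ^+ 2 - 4 * (s - 1) * (s - m)).
Proof.
move=> h; rewrite -lerBlDl; apply: le_trans (ler_norm _) _.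
by rewrite -sqrtr_sqr ler_wsqrtr //; lra.
Qed.

Lemma quadratic_root_eq (R : rcfType) (s m y : R) :
  s * (s - 1) <= (m - y) * (s + y - 1) ->
  2 * y = m + 1 - s + Num.sqrt ((m + 1 - s) ^+ 2 - 4 * (s - 1) * (s - m)) ->
  s * (s - 1) = (m - y) * (s + y - 1).
Proof.
move=> h /(canLR (addKr _)) /(congr1 (fun t => t ^+ 2)).
rewrite sqr_sqrtr; first lra.
(* By [h] the discriminant is at least a square, so its root may be squared. *)
by apply: le_trans (sqr_ge0 (2 * y - (m + 1 - s))) _; lra.
Qed.

Theorem theorem1 (R : rcfType) (G : sgraph) (n m chi : nat) (lambda : R)
  (hn : #|G| = n) (hm : gsize G = m) (hm1 : (1 <= m)%N)
  (hchi : chromatic_number G = chi)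
  (hlambda : is_least_eigenvalue (adjacency R G) lambda) :
  let rhs : R :=
    m%:R + 1 - lambda ^+ 2 +
    Num.sqrt ((m%:R + 1 - lambda ^+ 2) ^+ 2
              - 4 * (lambda ^+ 2 - 1) * (lambda ^+ 2 - m%:R)) in
  chi%:R * (chi%:R - 1) <= rhs /\
  (chi%:R * (chi%:R - 1) = rhs <->
     giso G (disjoint_union (complete_graph chi) (empty_graph (n - chi))) \/
     (chi = 2%N /\
      exists a b : nat,
        [/\ (1 <= a)%N, (1 <= b)%N &
            giso G (disjoint_union (complete_bipartite a b)
                                   (empty_graph (n - a - b)))])).
Proof.
move=> rhs; rewrite /rhs {rhs}.
have m0 : (0 < gsize G)%N by rewrite hm.
have [mu mu0 lE] : exists2 mu : R, 0 < mu & lambda = - mu.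
  by exists (- lambda); rewrite ?oppr_gt0 ?opprK // (least_eigenvalue_lt0 m0 hlambda).
have [eig least] := hlambda.
have [x norm1 energy] := unit_eigenvector eig.
rewrite lE in energy; rewrite lE sqrrN; set s := mu ^+ 2.
have s0 : 0 < s by rewrite exprn_gt0.
have [k chik] : exists k, chi = k.+1.
  by have := chromatic_gt1 m0; rewrite hchi; case: chi {hchi} => // k _; exists k.
have k1 : (0 < k)%N by have := chromatic_gt1 m0; rewrite hchi chik.
have nk : ~ colors_in [set: G] k by apply: chromatic_not_colors; rewrite hchi chik.
have [y y2] : exists y, (2 * y = k.+1 * k)%N.
  exists 'C(k.+1, 2); have := bin_ffact k.+1 2.
  by rewrite ffactnS ffactn1 (_ : 2`! = 2)%N //=; lia.
have yR : chi%:R * (chi%:R - 1) = 2 * y%:R :> R.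
  by rewrite -(natrM R 2) y2 natrM chik -[X in _ * (X - 1)]natr1 addrK.
rewrite yR.
have dens : dense [set: G] k by have [//|ck] := dense_or_colors [set: G] k; case: (nk ck).
have arcsT : arcs_in [set: G] = (2 * m)%N.
  by rewrite -hm -arcs_gsize; apply/eqP; rewrite eqn_leq !arcs_sub // => i j; rewrite !inE.
have ym : (y <= m)%N by have := dense_arcs dens; rewrite arcsT; lia.
have sm : s <= m%:R by rewrite -hm; exact: eigenvalue_le_size mu0 norm1 energy.
have cliqueP : y = m -> exists2 W : {set G}, #|W| = chi & spanned_by_clique W.
  move=> ymE; have [|W [_ cW clW inW]] := dense_arcs_eq k1 dens.
    by rewrite arcsT; lia.
  exists W; rewrite ?chik //; split=> // i j; apply: inW; exact: in_setT.
have s_clique : y = m -> s <= 1.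
  case/cliqueP=> W cW [clW inW].
  have degW : {in W, forall i, k <= deg_in W i}%N.
    move=> i iW; rewrite -ltnS -chik -cW (cardsD1 i) iW add1n ltnS.
    apply/subset_leq_card/subsetP=> j.
    by rewrite !inE => /andP[ji jW]; rewrite jW clW // eq_sym.
  (* With [z = 0] and no edge outside the clique the estimate reads [mu^2 <= mu]. *)
  have [|le _] := @eigenvalue_le_mindeg R G k x mu mu0 norm1 energy W 0 _ degW.
    by rewrite addn0 cW chik.
  have mE : (2 * gsize G = k.+1 * k)%N.
    have := gsize_clique (conj clW inW); rewrite cW chik /= hm; lia.
  move: le; rewrite addn0 mE /s => le; have mu1 : mu <= 1 by nra.
  by nra.
have mainle : s * (s - 1) <= (m%:R - y%:R) * (s + y%:R - 1).
  have [ymE|ym'] := eqVneq y m.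
    by rewrite ymE subrr mul0r; have := s_clique ymE; nra.
  have {}ym' : (y < gsize G)%N by rewrite hm ltn_neqAle ym'.
  have [k2|k2] := ltnP 1 k.
    by rewrite -hm ltW //; apply: strict_bound energy _ y2 k2 ym'.
  (* Now [chi = 2], and the inequality is [s * (s - 1) <= (m - 1) * s], that is [s <= m]. *)
  have -> : y = 1%N by nia.
  by nra.
split; first exact: quadratic_root_bound.
split=> [/(quadratic_root_eq mainle) eq|].
  have [ymE|ym'] := eqVneq y m.
    by left; have [W <- spW] := cliqueP ymE; rewrite -hn; apply: giso_complete.
  have ym2 : (y < gsize G)%N by rewrite hm ltn_neqAle ym'.
  have [k2|k2] := ltnP 1 k.
    have := strict_bound nk mu0 norm1 energy y2 k2 ym2.
    by rewrite hm -/s eq ltxx.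
  right; split; first by rewrite chik; congr S; lia.
  have y1 : y = 1%N by nia.
  have ms : (gsize G)%:R <= mu ^+ 2.
    rewrite hm -/s; rewrite y1 in eq.
    have : s * (s - m%:R) = 0 by lra.
    by move/eqP; rewrite mulf_eq0 gt_eqF //= subr_eq0 => /eqP->.
  have biP := eigenvalue_eq_size mu0 norm1 energy ms.
  set P := [set i | 0 < x i] in biP; set N := [set i | x i < 0] in biP.
  exists #|P|, #|N|.
  have [PN0] : (0 < #|P| * #|N|)%N by apply: leq_trans (gsize_biclique biP).
  by rewrite muln_gt0 in PN0; case/andP: PN0 => P0 N0; split=> //; rewrite -hn; apply: giso_bipartite.
case=> [/giso_completeP[W cW spW]|[chi2 [a [b [a1 b1 /giso_bipartiteP[P [N [cP cN spPN]]]]]]]].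
  have ymE : y = m.
    have := gsize_clique spW; rewrite cW chik /= hm; lia.
  (* The eigenvalue [-1] forces [s = 1], and the right side becomes [m + m = 2 * y]. *)
  have mu1 : 1 <= mu.
    have := least _ (clique_eigenvalue R spW _); rewrite lE lerN2; apply.
    by rewrite cW chik ltnS.
  have -> : s = 1 by have := s_clique ymE; rewrite /s; nra.
  rewrite subrr mulr0 mul0r subr0 addrK sqrtr_sqr ger0_norm ?ler0n // ymE; ring.
have y1 : y = 1%N by move: chi2 y2; rewrite chik => -[->]; lia.
(* The eigenvalue given by the biclique yields [s >= a * b >= m]; the discriminant is then 1. *)
have -> : s = m%:R.
  apply/eqP; rewrite eq_le sm /=.
  have := least _ (biclique_eigenvalue R spPN _ _); rewrite lE lerN2 cP cN => /(_ a1 b1) le.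
  have : (m%:R : R) <= (a * b)%:R by rewrite ler_nat -hm -cP -cN gsize_biclique.
  move/le_trans; apply; rewrite -(@sqr_sqrtr _ (a * b)%:R) ?ler0n // /s.
  by rewrite ler_sqr ?nnegrE ?sqrtr_ge0 // ltW.
have -> : (m%:R + 1 - m%:R) ^+ 2 - 4 * (m%:R - 1) * (m%:R - m%:R) = 1 :> R by ring.
by rewrite sqrtr1 y1; ring.
Qed.
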